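(* Let $K$ be a field, let $g\ge 2$ and $n\ge 1$ be integers, and let $m_1,\ldots,m_n$ be integers with $m_n\ge 0$, $m_{n-1}\ge 1$ and $m_i\ge 2$ for $1\le i\le n-2$ (conditions on indices smaller than $1$ being vacuous). Let $R$ be the polynomial ring and $I=I_{g,(m_1,\ldots,m_n)}\subseteq R$ the homogeneous ideal defined in the context. Then $$\operatorname{pd}(R/I)=\prod_{i=1}^{n-1}\left(\frac{(m_i+g-1)!}{(g-1)!\,(m_i)!}-g\right)\cdot\left(\frac{(m_n+g-1)!}{(g-1)!\,(m_n)!}\right)+gn.$$
   Context: Set $M_n=m_n$ and $M_k=m_k-1$ for $1\le k<n$; set $d_k=m_k+m_{k+1}+\cdots+m_n+1$ for $1\le k\le n$, and $d=d_1$. For $0\le k\le n$ let $\mathcal{A}_k$ be the set of $g\times n$ integer matrices $A=(a_{j,k'})$ (with $1\le j\le g$, $1\le k'\le n$) such that: for $1\le k'\le k$, $0\le a_{j,k'}\le M_{k'}$ for all $j$ and $\sum_{j=1}^g a_{j,k'}=m_{k'}$; and for $k<k'\le n$, $a_{j,k'}=0$ for all $j$. (So $\mathcal{A}_0$ consists only of the zero matrix.) Let $R=K[x_{j,k},\,y_A \mid 1\le j\le g,\ 1\le k\le n,\ A\in\mathcal{A}_n]$ be the polynomial ring in these variables with its standard grading (all variables in degree $1$). For a $g\times n$ matrix $A=(a_{j,k})$ of nonnegative integers write $X^A=\prod_{j,k}x_{j,k}^{a_{j,k}}$. Define $$I_{g,(m_1,\ldots,m_n)}=(x_{1,1}^d,\ldots,x_{g,1}^d,f),$$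 $$f=\sum_{k=1}^{n-1}\ \sum_{A\in\mathcal{A}_{k-1}}\ \sum_{j=1}^g X^A\,x_{j,k}^{m_k}\,x_{j,k+1}^{d_{k+1}}\;+\;\sum_{B\in\mathcal{A}_n}X^B\,y_B,$$ where empty sums are $0$. $\operatorname{pd}(R/I)$ denotes the projective dimension of $R/I$ as an $R$-module, i.e. the length of its minimal graded free resolution. An empty product equals $1$. *)

(* Defs.v *)
From HB Require Import structures.
From mathcomp Require Import all_boot all_algebra.
From mathcomp Require Import mpoly.
From mathcomp.classical Require Import boolp.

Set Implicit Arguments.
Unset Strict Implicit.
Unset Printing Implicit Defensive.

Import GRing.Theory.
Local Open Scope ring_scope.
Local Open Scope quotient_scope.

Section ProjectiveDimension.
Variable R : nzRingType.

Definition surjective (A B : Type) (f : A -> B) : Prop :=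
  forall y, exists x, f x = y.

Definition projective (P : lmodType R) : Prop :=
  forall (A B : lmodType R) (e : {linear A -> B}) (f : {linear P -> B}),
    surjective e -> exists h : {linear P -> A}, forall x, e (h x) = f x.

Record proj_resolution (M : lmodType R) := ProjResolution {
  res_mod : nat -> lmodType R;
  res_diff : forall i, {linear res_mod i.+1 -> res_mod i};
  res_aug : {linear res_mod 0%N -> M};
  res_proj : forall i, projective (res_mod i);
  res_aug_surj : surjective res_aug;
  res_exact0 : forall x, res_aug x = 0 <-> exists y, res_diff 0%N y = x;
  res_exactS : forall i x,
    res_diff i x = 0 <-> exists y, res_diff i.+1 y = x }.

(* No nonvanishing is required in degree p: the length is at most p. *)
Definition has_proj_resolution_le (M : lmodType R) (p : nat) : Prop :=
  exists F : proj_resolution M,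
    forall i, (p < i)%N -> forall x : res_mod F i, x = 0.

(* [is_pd M p] says that M has finite projective dimension p (for M = 0 this
   gives 0 instead of the conventional -oo). *)
Definition is_pd (M : lmodType R) (p : nat) : Prop :=
  has_proj_resolution_le M p /\
  forall q, has_proj_resolution_le M q -> (p <= q)%N.

End ProjectiveDimension.

Section GeneratedIdeal.
Variables (R : comNzRingType) (G : R -> Prop).

Definition gen_ideal : {pred R^o} := fun p : R =>
  `[< exists s : seq (R * R), (forall q, q \in s -> G q.2) /\
        p = \sum_(q <- s) q.1 * q.2 >].

Let gen_ideal_submod : submod_closed gen_ideal.
Proof.
split=> [|a u v /asboolP[s [Gs ->]] /asboolP[t [Gt ->]]]; apply/asboolP.
  by exists [::]; rewrite big_nil; split.
exists ([seq (a * q.1, q.2) | q <- s] ++ t); split.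
  by move=> q; rewrite mem_cat => /orP[/mapP[q' /Gs Gq' ->]|/Gt].
rewrite big_cat big_map /=; congr (_ + _).
by rewrite [LHS]mulr_sumr; apply: eq_bigr => q _; rewrite mulrA.
Qed.

HB.instance Definition _ := GRing.isSubmodClosed.Build R R^o gen_ideal
  gen_ideal_submod.

Definition quot_ring_mod : Type := {ideal_quot gen_ideal}.

HB.instance Definition _ := GRing.Zmodule.on quot_ring_mod.

Definition quot_scale (a : R) (x : quot_ring_mod) : quot_ring_mod :=
  \pi_({ideal_quot gen_ideal}) (a *: repr x).

Lemma quot_scale_pi (a : R) (v : R^o) :
  quot_scale a (\pi_({ideal_quot gen_ideal}) v)
  = \pi_({ideal_quot gen_ideal}) (a *: v).
Proof.
apply/eqP; rewrite -Quotient.idealrBE -scalerBr; apply: rpredZ.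
by rewrite Quotient.idealrBE reprK.
Qed.

Let quotP (P : quot_ring_mod -> Prop) :
  (forall v : R^o, P (\pi_({ideal_quot gen_ideal}) v)) -> forall x, P x.
Proof. by move=> h x; rewrite -[x](@reprK _ {ideal_quot gen_ideal}). Qed.

Let scaleA a b v : quot_scale a (quot_scale b v) = quot_scale (a * b) v.
Proof. by elim/quotP: v => v; rewrite !quot_scale_pi scalerA. Qed.

Let scale1 : left_id 1 quot_scale.
Proof. by elim/quotP=> v; rewrite quot_scale_pi scale1r. Qed.

Let scaleDr : right_distributive quot_scale +%R.
Proof.
move=> a; elim/quotP=> u; elim/quotP=> v.
have piD (x y : R^o) : \pi_({ideal_quot gen_ideal}) x
    + \pi_({ideal_quot gen_ideal}) y = \pi_({ideal_quot gen_ideal}) (x + y).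
  by rewrite [RHS]raddfD.
by rewrite !quot_scale_pi [in LHS]piD quot_scale_pi [RHS]piD scalerDr.
Qed.

Let scaleDl v : {morph quot_scale^~ v : a b / a + b}.
Proof.
elim/quotP: v => v a b; rewrite !quot_scale_pi scalerDl.
by rewrite [LHS]raddfD.
Qed.

HB.instance Definition _ := GRing.Zmodule_isLmodule.Build R quot_ring_mod
  scaleA scale1 scaleDr scaleDl.

End GeneratedIdeal.

(* The sequence is m 1, ..., m n (other values of m are irrelevant).  Matrix
   indices are ordinals starting at 0, so the column of ordinal index c is the
   mathematical column c.+1. *)
Section Ideal.
Variables (g n : nat) (m : nat -> nat).

Definition Mbound (k : nat) : nat := if k == n then m k else (m k - 1)%N.

Definition dexp (k : nat) : nat := (\sum_(k <= i < n.+1) m i + 1)%N.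

(* All matrices of the sets A_k have entries at most max(m 1, ..., m n), so
   they can be collected inside a finite type. *)
Definition expmx : finType :=
  'M['I_(\max_(1 <= i < n.+1) m i).+1]_(g, n).

Definition calA (k : nat) : {set expmx} :=
  [set A : expmx | [forall c : 'I_n,
     if (c.+1 <= k)%N then
       [forall j : 'I_g, (A j c <= Mbound c.+1)%N] &&
       (\sum_(j < g) A j c == m c.+1)%N
     else [forall j : 'I_g, A j c == 0%N :> nat]]].

(* index type of the variables: x_{j,k} and y_A *)
Definition vars : finType := (('I_g * 'I_n) + {A : expmx | A \in calA n})%type.

Variable K : fieldType.

Definition polyR : comNzRingType := {mpoly K[#|vars|]}.

Definition xvar (j : 'I_g) (c : 'I_n) : polyR :=
  'X_(enum_rank (inl (j, c) : vars)).

Definition yvar (A : {A : expmx | A \in calA n}) : polyR :=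
  'X_(enum_rank (inr A : vars)).

Definition Xmon (A : expmx) : polyR :=
  \prod_(j < g) \prod_(c < n) xvar j c ^+ A j c.

(* With c = k - 1 and c' = k: the inner sum over c' has one term when k < n
   and is empty when k = n. *)
Definition fpoly : polyR :=
  \sum_(c < n) \sum_(c' < n | c' == c.+1 :> nat)
    \sum_(A in calA c) \sum_(j < g)
      Xmon A * xvar j c ^+ m c.+1 * xvar j c' ^+ dexp c'.+1
  + \sum_(B : {A : expmx | A \in calA n}) Xmon (val B) * yvar B.

Definition Igens (p : polyR) : Prop :=
  (exists (j : 'I_g) (c : 'I_n), c = 0%N :> nat /\ p = xvar j c ^+ dexp 1)
  \/ p = fpoly.

Definition RmodI : lmodType polyR := quot_ring_mod Igens.

End Ideal.

(* Main.v *)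
Require Import Defs.
From HB Require Import structures.
From mathcomp Require Import all_boot all_order all_algebra.
From mathcomp Require Import mpoly.
From mathcomp.classical Require Import boolp.
From mathcomp Require Import zify.

(** Write [S] for the polynomial ring in [N] variables and [I] for the ideal.
    The claim is that [S/I] has the largest projective dimension that
    Hilbert's syzygy theorem allows, namely the number [N] of variables.
    Counting the variables ([card_vars]) turns [N] into the stated formula:
    a column of a matrix in [calA n] is a composition of [m_k] into [g] parts,
    and for [k < n] the [g] compositions with a part equal to [m_k] are left
    out.

    Two facts give projective dimension [N].

    Homological part ([is_pd_cyclic]): a cyclic [S]-module [M] that contains a
    nonzero element [s] killed by all variables has projective dimension [N].
    Write [M = Q] with [Q] a quotient ring of [S], let [t_i] be the image of
    the variable [X_i] in [Q], and put [A = Q[X_1, ..., X_N]].  As an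
    [S]-module (through [X_i |-> X_i]) [A] is the tensor product of [S] and [Q]
    over the ground field, hence projective ([projective_base_change]).  The
    elements [X_i - t_i] form a regular sequence in [A] with quotient [Q], so
    their Koszul complex is a projective resolution of [Q] of length [N].
    Conversely, let [P] be a projective resolution of length less than [N].
    Comparing the Koszul resolution [F] with [P], back and forth up to
    homotopy, yields a retraction of the last differential of [F]
    ([retraction_of_short_resolution]).  But that differential sends [s] to a
    combination with coefficients [X_i - t_i], and [t_i s = 0]; so [s] would
    lie in [(X_1, ..., X_N) A], which is absurd at [X = 0]
    ([koszul_no_retraction]).

    Combinatorial part: let [T] be the product of all [x_{j,k}^(d_k - 1)].
    Then [T] is not in [I], because [I] is contained in the monomial ideal
    generated by the [y_B] and the [x_{j,k}^d_k] ([socle_notin]).  Every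
    variable multiplies [T] into [I].  The key claim ([beyond_topP]), proved by
    induction on [k], is that a monomial lies in [I] as soon as it is divisible
    by [x_{j,k}^d_k] and by [x_{i,l}^(d_l - 1)] for all [i] and all [l < k].
    For the step from [k] to [k + 1], multiply [f] by the quotient of
    [prod_{l <= k} x_{i,l}^(d_l - 1)] by the monomial
    [X^A x_{j,k}^m_k].  One term of the result is the wanted monomial.  The
    exponent matrix of any other term of [f] differs from that of
    [X^A x_{j,k}^m_k] in some column at most [k]; columns have prescribed sums,
    so in the first differing column some exponent is too large and induction
    puts the term in [I] ([differing_term]).  The same computation with [X^B]
    in place of [X^A x_{j,k}^m_k] gives [y_B T] in [I]
    ([mul_yvar_socle]). *)

Set Implicit Arguments.
Unset Strict Implicit.
Unset Printing Implicit Defensive.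

Import Order.TTheory GRing.Theory.
Local Open Scope ring_scope.
Local Open Scope quotient_scope.

(** * Comparison of projective resolutions *)

Definition mklin (R : nzRingType) (U V : lmodType R) (f : U -> V)
    (lin_f : linear f) : {linear U -> V} :=
  HB.pack_for {linear U -> V} f (GRing.isLinear.Build R U V *:%R f lin_f).

(** The image of a linear map as a module of its own: [projective] speaks of
    surjections only, so a lift through a non-surjective map is obtained by
    first corestricting to the image. *)
Section ImageModule.
Variables (R : nzRingType) (U V : lmodType R) (f : {linear U -> V}).

Definition im_pred : {pred V} := fun v => `[< exists u, f u = v >].

Lemma im_submod : submod_closed im_pred.
Proof.
split=> [|a v w /asboolP[x <-] /asboolP[y <-]]; apply/asboolP.
  by exists 0; rewrite linear0.
by exists (a *: x + y); rewrite linearP.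
Qed.

HB.instance Definition _ := GRing.isSubmodClosed.Build R V im_pred im_submod.

Record im_mod := ImMod { im_val : V; im_valP : im_val \in im_pred }.
HB.instance Definition _ := [isSub for im_val].
HB.instance Definition _ := [Choice of im_mod by <:].
HB.instance Definition _ := [SubChoice_isSubLmodule of im_mod by <:].

End ImageModule.

Section Comparison.
Variable R : nzRingType.
Implicit Types (U V W P : lmodType R).

Lemma projective_lift P U V (e : {linear U -> V}) (f : {linear P -> V}) :
    projective P -> (forall x, exists y, e y = f x) ->
  exists h : {linear P -> U}, forall x, e (h x) = f x.
Proof.
move=> projP im_f.
have e_im x : e x \in im_pred e by apply/asboolP; exists x.
have f_im x : f x \in im_pred e by apply/asboolP.
have e_lin : linear (fun x => ImMod (e_im x)).
  by move=> a x y; apply: val_inj; rewrite /= linearP.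
have f_lin : linear (fun x => ImMod (f_im x)).
  by move=> a x y; apply: val_inj; rewrite /= linearP.
have e_surj : surjective (mklin e_lin).
  by case=> v v_im; have /asboolP[x ex] := v_im; exists x; apply: val_inj.
by have [h hP] := projP _ _ _ (mklin f_lin) e_surj; exists h => x; case: (hP x).
Qed.

Variables (M : lmodType R) (F P : proj_resolution M).

(** The state of the inductive construction of chain maps [phi : F -> P],
    [psi : P -> F] and a homotopy [h] from the identity of [F] to
    [psi \o phi].  Each component is recorded only on boundaries, where the
    homotopy identity does not involve the previous component of [h]; this is
    what makes the induction self-contained. *)
Definition comparison_step (i : nat) (phi : {linear res_mod F i -> res_mod P i})
    (psi : {linear res_mod P i -> res_mod F i})
    (h : {linear res_mod F i -> res_mod F i.+1}) :=
  [/\ forall x, exists y, res_diff P i y = phi (res_diff F i x),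
      forall x, exists y, res_diff F i y = psi (res_diff P i x) &
      forall x, res_diff F i x - psi (phi (res_diff F i x))
                = res_diff F i (h (res_diff F i x))].

Lemma comparison (i : nat) : exists phi psi h, @comparison_step i phi psi h.
Proof.
elim: i => [|i [phi [psi [h [phiP psiP hP]]]]].
  have [phi phiP] : exists phi : {linear res_mod F 0 -> res_mod P 0},
      forall x, res_aug P (phi x) = res_aug F x.
    apply: (projective_lift (e := res_aug P) (f := res_aug F)) => [|x].
      exact: (@res_proj _ _ F 0).
    exact: res_aug_surj.
  have [psi psiP] : exists psi : {linear res_mod P 0 -> res_mod F 0},
      forall x, res_aug F (psi x) = res_aug P x.
    apply: (projective_lift (e := res_aug F) (f := res_aug P)) => [|x].
      exact: (@res_proj _ _ P 0).
    exact: res_aug_surj.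
  have dF x : res_aug F (res_diff F 0 x) = 0 by apply/res_exact0; exists x.
  have dP x : res_aug P (res_diff P 0 x) = 0 by apply/res_exact0; exists x.
  have lin_g : linear (fun x => x - psi (phi x)).
    by move=> a x y; rewrite !linearP addrACA -scalerDr.
  have [h hP] : exists h : {linear res_mod F 0 -> res_mod F 1},
      forall x, res_diff F 0 (h x) = mklin lin_g x.
    apply: (projective_lift (e := res_diff F 0) (f := mklin lin_g)) => [|x].
      exact: (@res_proj _ _ F 0).
    by apply/res_exact0; rewrite raddfB /= psiP phiP subrr.
  exists phi, psi, h; split=> x.
  - by apply/res_exact0; rewrite phiP dF.
  - by apply/res_exact0; rewrite psiP dP.
  - by rewrite hP.
have dF x : res_diff F i (res_diff F i.+1 x) = 0 by apply/res_exactS; exists x.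
have dP x : res_diff P i (res_diff P i.+1 x) = 0 by apply/res_exactS; exists x.
have [phi' phi'P] := projective_lift
  (f := phi \o res_diff F i) (@res_proj _ _ F i.+1) phiP.
have [psi' psi'P] := projective_lift
  (f := psi \o res_diff P i) (@res_proj _ _ P i.+1) psiP.
have lin_g : linear (fun x => x - psi' (phi' x) - h (res_diff F i x)).
  move=> a x y; rewrite !linearP [X in X + _ = _]addrACA -scalerDr.
  by rewrite addrACA -scalerDr.
have [h' h'P] : exists h' : {linear res_mod F i.+1 -> res_mod F i.+2},
    forall x, res_diff F i.+1 (h' x) = mklin lin_g x.
  apply: (projective_lift (e := res_diff F i.+1) (f := mklin lin_g)) => [|x].
    exact: (@res_proj _ _ F i.+1).
  by apply/res_exactS; rewrite !raddfB /= psi'P /= phi'P /= hP subrr.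
exists phi', psi', h'; split=> x.
- by apply/res_exactS; rewrite phi'P /= dF linear0.
- by apply/res_exactS; rewrite psi'P /= dP linear0.
- by rewrite h'P /= dF linear0 subr0.
Qed.

(** If [P] vanishes in degree [i.+1], then [phi] kills the boundaries of [F] in
    degree [i], so the homotopy identity reads [d x = d (h (d x))]; it remains
    to cancel [d]. *)
Lemma retraction_of_short_resolution (i : nat) :
    (forall x, res_diff F i x = 0 -> x = 0) ->
    (forall x : res_mod P i.+1, x = 0) ->
  exists r : {linear res_mod F i -> res_mod F i.+1},
    forall x, r (res_diff F i x) = x.
Proof.
move=> injF P0; have [phi [psi [h [phiP psiP hP]]]] := comparison i.
exists h => x; apply/eqP; rewrite -subr_eq0; apply/eqP/injF.
rewrite raddfB /= -hP; have [y <-] := phiP x.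
by rewrite (P0 y) linear0 linear0 subr0 subrr.
Qed.

End Comparison.

(** * Koszul complexes as iterated mapping cones *)

Lemma zero_linear (R : nzRingType) (U V : lmodType R) :
  linear (fun _ : U => 0 : V).
Proof. by move=> a u v; rewrite scaler0 addr0. Qed.

Section Koszul.
Variable A : comNzRingType.

Record chain_complex := ChainComplex {
  chain_mod : nat -> lmodType A;
  chain_diff : forall i, {linear chain_mod i.+1 -> chain_mod i} }.

(** The mapping cone of multiplication by [a] on a complex, which computes the
    Koszul complex of one more element.  Building Koszul complexes this way
    avoids exterior powers and their signs. *)
Definition cone_mod (C : chain_complex) (p : nat) : lmodType A :=
  if p is p'.+1 then (chain_mod C p * chain_mod C p')%type else chain_mod C 0.

Definition cone_fun (a : A) (C : chain_complex) (p : nat) :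
    cone_mod C p.+1 -> cone_mod C p :=
  match p return cone_mod C p.+1 -> cone_mod C p with
  | 0 => fun w => chain_diff C 0 w.1 + a *: w.2
  | p'.+1 => fun w => (chain_diff C p'.+1 w.1 + a *: w.2, - chain_diff C p' w.2)
  end.

Lemma cone_linear a C p : linear (@cone_fun a C p).
Proof.
have lin1 q : linear (fun w : chain_mod C q.+1 * chain_mod C q =>
    chain_diff C q w.1 + a *: w.2).
  move=> b u v /=; rewrite linearP scalerDr scalerA [a * b]mulrC -scalerA.
  by rewrite addrACA -scalerDr.
case: p => [|p] b u v /=; first exact: lin1.
by congr pair; rewrite ?lin1 //= linearP opprD -scalerN.
Qed.

Definition cone a C := ChainComplex (fun p => mklin (@cone_linear a C p)).

Lemma pairr_linear (W U V : lmodType A) (f : {linear U -> V}) :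
  linear (fun u => (0 : W, f u)).
Proof. by move=> a u v; congr pair; rewrite /= ?linearP // scaler0 addr0. Qed.

Definition ground_mod (p : nat) : lmodType A :=
  if p is 0 then A^o else 'rV[A]_0.

Definition ground := @ChainComplex ground_mod
  (fun p => mklin (@zero_linear A (ground_mod p.+1) (ground_mod p))).

Variable phi : nat -> A.

Fixpoint koszul (k : nat) : chain_complex :=
  if k is k'.+1 then cone (phi k') (koszul k') else ground.

(** The degree-0 term of [koszul k] is a copy of the ring, but this reduces only
    when [k] is a numeral; [degree0_in] and [degree0_out] are the
    identifications. *)
Fixpoint degree0_in (k : nat) : {linear A^o -> chain_mod (koszul k) 0} :=
  match k return {linear A^o -> chain_mod (koszul k) 0} with
  | 0 => idfun
  | k'.+1 => degree0_in k'
  end.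

Fixpoint degree0_out (k : nat) : {linear chain_mod (koszul k) 0 -> A^o} :=
  match k return {linear chain_mod (koszul k) 0 -> A^o} with
  | 0 => idfun
  | k'.+1 => degree0_out k'
  end.


Definition exact_chain (C : chain_complex) := forall i x,
  chain_diff C i x = 0 <-> exists y, chain_diff C i.+1 y = x.

(** The hypothesis on [a] says that it acts injectively on the zeroth homology
    of [C].  The long exact sequence of the cone then kills every homology in
    positive degree; the proof is the corresponding diagram chase. *)
Lemma cone_exact a C : exact_chain C ->
    (forall v, (exists u, chain_diff C 0 u = a *: v) ->
       exists u, chain_diff C 0 u = v) ->
  exact_chain (cone a C).
Proof.
move=> exC reg_a.
have dd i x : chain_diff C i (chain_diff C i.+1 x) = 0 by apply/exC; exists x.
have fill i (u : chain_mod C i.+1) (w : chain_mod C i.+1) :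
    chain_diff C i u + a *: chain_diff C i w = 0 ->
  exists z, chain_diff C i.+1 z + a *: - w = u.
  rewrite -linearZ -linearD /= => /exC[z zE].
  by exists z; rewrite zE scalerN addrK.
case=> [|i] [u v]; split=> /=.
- move=> uv0; have [w wE] : exists w, chain_diff C 0 w = v.
    apply: reg_a; exists (- u); rewrite linearN.
    by apply/eqP; rewrite eq_sym -addr_eq0 addrC uv0.
  rewrite -wE in uv0 *; have [z zE] := fill _ _ _ uv0.
  by exists (z, - w); rewrite /= zE linearN opprK.
- case=> [[z w] /= [<- <-]].
  by rewrite linearD /= dd add0r linearZ scalerN subrr.
- case=> uv0 /eqP; rewrite oppr_eq0 => /eqP/exC[w wE].
  rewrite -wE in uv0 *; have [z zE] := fill _ _ _ uv0.
  by exists (z, - w); rewrite /= zE linearN opprK.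
- case=> [[z w] /= [<- <-]].
  congr pair; first by rewrite linearD /= dd add0r linearZ scalerN subrr.
  by rewrite (linearN (chain_diff C i)) dd !oppr0.
Qed.

Definition in_ideal (k : nat) (x : A) :=
  exists b : nat -> A, x = \sum_(i < k) phi i * b i.

Definition regular_seq (N : nat) :=
  forall k, (k < N)%N -> forall x, in_ideal k (phi k * x) -> in_ideal k x.

Lemma degree0_inK k : cancel (degree0_in k) (degree0_out k).
Proof. by elim: k. Qed.

Lemma koszul_im0 k x :
  (exists u, chain_diff (koszul k) 0 u = x) <-> in_ideal k (degree0_out k x).
Proof.
elim: k x => [|k IHk] x /=.
  split=> [[u <-]|[b]]; first by exists (fun=> 0); rewrite big_ord0.
  by rewrite big_ord0 => <-; exists 0.
split=> [[[u v] /= <-]|[b xE]].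
  have [b bE] := (IHk (chain_diff (koszul k) 0 u)).1 (ex_intro _ u erefl).
  exists (fun i => if i == k then degree0_out k v else b i).
  rewrite linearD linearZ bE big_ord_recr /= eqxx; congr (_ + _).
  by apply: eq_bigr => i _; rewrite ltn_eqF.
have [|u uE] := (IHk (x - phi k *: degree0_in k (b k))).2.
  exists b; rewrite linearB linearZ degree0_inK xE big_ord_recr /=.
  exact: addrK.
by exists (u, degree0_in k (b k)); rewrite /= uE subrK.
Qed.

Lemma koszul_exact N : regular_seq N -> exact_chain (koszul N).
Proof.
elim: N => [|N IHN] regN.
  move=> i x; split=> _; last by [].
  by exists 0; rewrite [x]thinmx0.
apply: cone_exact => [|v].
  by apply: IHN => k ltkN; apply: regN; apply: ltnW.
move=> /koszul_im0; rewrite linearZ => /(regN N (ltnSn N)).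
by move/koszul_im0.
Qed.

Lemma koszul_vanish N i : (N < i)%N -> forall x : chain_mod (koszul N) i, x = 0.
Proof.
elim: N i => [|N IHN] [|i] // ltNi; first by move=> x; rewrite [x]thinmx0.
by case=> u v; rewrite [u]IHN 1?[v]IHN // ltnW.
Qed.

(** The top-degree term of the Koszul complex is again a copy of the ring. *)
Fixpoint koszul_top (k : nat) : {linear A^o -> chain_mod (koszul k) k} :=
  match k return {linear A^o -> chain_mod (koszul k) k} with
  | 0 => idfun
  | k'.+1 => mklin (pairr_linear (chain_mod (koszul k') k'.+1) (koszul_top k'))
  end.

Fixpoint koszul_bot (k : nat) : {linear chain_mod (koszul k) k -> A^o} :=
  match k return {linear chain_mod (koszul k) k -> A^o} with
  | 0 => idfun
  | k'.+1 => koszul_bot k' \o snd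
  end.

Lemma koszul_topK k : cancel (koszul_top k) (koszul_bot k).
Proof. by elim: k. Qed.

Definition in_span n (y : 'I_n -> A) (W : lmodType A) (w : W) :=
  exists c : 'I_n -> W, w = \sum_j y j *: c j.

Lemma in_span_scale n (y : 'I_n -> A) (W : lmodType A) j (w : W) :
  in_span y (y j *: w).
Proof.
exists (fun i => if i == j then w else 0).
by rewrite (bigD1 j) //= eqxx big1 ?addr0 // => i /negPf->; rewrite scaler0.
Qed.

(** Up to sign, the components of the differential of a top-degree element [a]
    are the products of [a] with the members of the sequence; each of these is
    supposed to be a product of [a] with some [y_j]. *)
Lemma koszul_top_diff n (y : 'I_n -> A) k (a : A^o) :
    (forall i, (i <= k)%N -> exists j, phi i *: a = y j *: a) ->
  in_span y (chain_diff (koszul k.+1) k (koszul_top k.+1 a)).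
Proof.
elim: k => [|k IHk] phi_a.
  rewrite /=; have [j ->] := phi_a 0 isT.
  by rewrite add0r; apply: in_span_scale.
have [c cE] := IHk (fun i leik => phi_a i (leqW leik)).
have [j jE] := phi_a _ (leqnn k.+1).
have [b bE] : in_span y (phi k.+1 *: koszul_top k.+1 a).
  by rewrite -linearZ_LR jE linearZ_LR; apply: in_span_scale.
exists (fun i => (b i, - c i)).
transitivity (phi k.+1 *: koszul_top k.+1 a,
              - chain_diff (koszul k.+1) k (koszul_top k.+1 a)).
  by congr pair; rewrite linear0 add0r.
rewrite bE cE -sumrN.
elim/big_rec3: _ => // i u v w _ <-.
by rewrite -[RHS]/(y i *: b i + w, y i *: - c i + v) scalerN.
Qed.

End Koszul.

(** Restriction of scalars along a ring morphism: the Koszul complex lives over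
    the larger ring, the resolution is wanted over the smaller one. *)
Section Restriction.
Variables (R A : nzRingType).

(** An alias of [W], which records [f] so that the instance of the module
    structure over [R] can be found from the type. *)
Definition restr (f : {rmorphism R -> A}) (W : lmodType A) : Type := W.

Variable f : {rmorphism R -> A}.
HB.instance Definition _ W := GRing.Zmodule.on (restr f W).

Section Scale.
Variable W : lmodType A.
Definition restr_scale (r : R) (w : restr f W) : restr f W := f r *: (w : W).
Lemma restr_scaleA a b v :
  restr_scale a (restr_scale b v) = restr_scale (a * b) v.
Proof. by rewrite /restr_scale scalerA rmorphM. Qed.
Lemma restr_scale1 : left_id 1 restr_scale.
Proof. by move=> v; rewrite /restr_scale rmorph1 scale1r. Qed.
Lemma restr_scaleDr : right_distributive restr_scale +%R.
Proof. by move=> a u v; rewrite /restr_scale scalerDr. Qed.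
Lemma restr_scaleDl v : {morph restr_scale^~ v : a b / a + b}.
Proof. by move=> a b; rewrite /restr_scale rmorphD scalerDl. Qed.
End Scale.

HB.instance Definition _ W := GRing.Zmodule_isLmodule.Build R (restr f W)
  (@restr_scaleA W) (@restr_scale1 W) (@restr_scaleDr W) (@restr_scaleDl W).

Lemma restrZ (W : lmodType A) (r : R) (w : restr f W) : r *: w = f r *: (w : W).
Proof. by []. Qed.

Lemma restr_linear (U V : lmodType A) (g : {linear U -> V}) :
  linear (g : restr f U -> restr f V).
Proof. by move=> a u v; rewrite restrZ linearP. Qed.

Definition restr_map (U V : lmodType A) (g : {linear U -> V}) :
  {linear restr f U -> restr f V} := mklin (restr_linear g).

Lemma projective_restr_prod (U V : lmodType A) :
  projective (restr f U) -> projective (restr f V) ->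
  projective (restr f (U * V)%type).
Proof.
move=> projU projV B C e h e_surj.
have linl : linear (fun u : restr f U => h (u, 0)).
  by move=> a u v; rewrite -linearP; congr (h _);
    apply: injective_projections; rewrite /= ?scaler0 ?addr0.
have linr : linear (fun v : restr f V => h (0, v)).
  by move=> a u v; rewrite -linearP; congr (h _);
    apply: injective_projections; rewrite /= ?scaler0 ?addr0.
have [hl hlE] := projU _ _ e (mklin linl) e_surj.
have [hr hrE] := projV _ _ e (mklin linr) e_surj.
have lin_h : linear (fun w : restr f (U * V)%type => hl w.1 + hr w.2).
  by move=> a u v; rewrite !linearP addrACA -scalerDr.
exists (mklin lin_h) => -[u v] /=; rewrite linearD hlE hrE /= -linearD.
by congr (h _); apply: injective_projections; rewrite /= ?addr0 ?add0r.
Qed.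

Lemma projective_zero (W : lmodType R) : (forall w : W, w = 0) -> projective W.
Proof.
move=> W0 B C e h _; exists (mklin (@zero_linear R W B)) => x.
by rewrite /= (W0 x) !linear0.
Qed.

End Restriction.

Lemma projective_koszul (R : nzRingType) (A : comNzRingType)
    (f : {rmorphism R -> A}) (phi : nat -> A) N i :
  projective (restr f A^o) -> projective (restr f (chain_mod (koszul phi N) i)).
Proof.
move=> projA; elim: N i => [|N IHN] [|i] /=; first exact: projA.
- by apply: projective_zero => x; apply: thinmx0.
- exact: IHN.
- exact: projective_restr_prod (IHN _) (IHN _).
Qed.

(** * The regular sequence of shifted variables *)

Section ShiftedVariables.
Variables (N : nat) (Q : comNzRingType) (t : 'I_N -> Q).
Local Notation A := {mpoly Q[N]}.

(** Indexed by natural numbers, as sequences are in the Koszul complex. *)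
Definition shifted_var (k : nat) : A :=
  if insub k is Some i then 'X_i - (t i)%:MP else 0.

Lemma shifted_varE (i : 'I_N) : shifted_var i = 'X_i - (t i)%:MP.
Proof. by rewrite /shifted_var valK. Qed.

(** The leading coefficient of ['X_i - t_i] is 1, whatever zero divisors the
    coefficient ring has. *)
Lemma shifted_var_lreg (i : 'I_N) (a : A) : shifted_var i * a = 0 -> a = 0.
Proof.
have lc1 : (shifted_var i)@_(U_(i)) = 1.
  rewrite shifted_varE mcoeffB mcoeffX eqxx mcoeffC mnm1_eq0.
  by rewrite mulr0 subr0.
have lead : mlead (shifted_var i) = U_(i)%MM.
  apply/le_anti/andP; split.
    rewrite shifted_varE (le_trans (mleadB_le _ _)) // mleadXm mleadC.
    by rewrite leUx lexx le0x.
  by apply: msupp_le_mlead; rewrite mcoeff_msupp lc1 oner_neq0.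
suff reg : GRing.lreg (shifted_var i) by move=> a0; apply: reg; rewrite mulr0.
by apply: lreg_mleadc; rewrite lead lc1; apply: lreg1.
Qed.

(** Substituting [t_i] for the first [k] variables; its kernel is the ideal of
    the first [k] shifted variables ([in_idealP]), which reduces regularity of
    the sequence to [shifted_var_lreg]. *)
Definition partial_eval (k : nat) : {rmorphism A -> A} :=
  comp_mpoly [tuple if (i < k)%N then (t i)%:MP else 'X_i | i < N].

Lemma partial_evalC k c : partial_eval k c%:MP = c%:MP.
Proof. exact: comp_mpolyC. Qed.

Lemma partial_evalX k (i : 'I_N) :
  partial_eval k 'X_i = if (i < k)%N then (t i)%:MP else 'X_i.
Proof. by rewrite /partial_eval /= comp_mpolyXU -tnth_nth tnth_mktuple. Qed.

Lemma partial_eval_var (i : 'I_N) k :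
  partial_eval k (shifted_var i) = if (i < k)%N then 0 else shifted_var i.
Proof.
rewrite shifted_varE rmorphB /= partial_evalC partial_evalX.
by case: ifP => _ //; rewrite subrr.
Qed.

Lemma in_idealP k (a : A) : (k <= N)%N ->
  in_ideal shifted_var k a <-> partial_eval k a = 0.
Proof.
move=> lekN; split=> [[b ->]|].
  rewrite rmorph_sum big1 // => i _; rewrite rmorphM /=.
  have ltiN := leq_trans (ltn_ord i) lekN.
  by rewrite (partial_eval_var (Ordinal ltiN)) /= ltn_ord mul0r.
suff: in_ideal shifted_var k (a - partial_eval k a).
  by move=> Ja a0; rewrite a0 subr0 in Ja.
have idD x y : in_ideal shifted_var k x -> in_ideal shifted_var k y ->
    in_ideal shifted_var k (x + y).
  move=> [b ->] [c ->]; exists (fun i => b i + c i).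
  by rewrite -big_split /=; apply: eq_bigr => i _; rewrite mulrDr.
have idM x y : in_ideal shifted_var k x -> in_ideal shifted_var k (x * y).
  move=> [b ->]; exists (fun i => b i * y).
  by rewrite mulr_suml; apply: eq_bigr => i _; rewrite mulrA.
have id0 : in_ideal shifted_var k 0.
  by exists (fun=> 0); rewrite big1 // => i _; rewrite mulr0.
pose good x := in_ideal shifted_var k (x - partial_eval k x).
have goodC c : good c%:MP by rewrite /good partial_evalC subrr.
have goodM x y : good x -> good y -> good (x * y).
  move=> gx gy; rewrite /good rmorphM /=.
  rewrite -(subrK (partial_eval k x * y) (x * y)) -mulrBl -addrA.
  apply: idD; first exact: idM.
  by rewrite -mulrBr mulrC; apply: idM.
have goodX (i : 'I_N) : good 'X_i.
  rewrite /good partial_evalX; case: ifP => [ltik|_]; last by rewrite subrr.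
  exists (fun j => (j == i :> nat)%:R).
  rewrite (bigD1 (Ordinal ltik)) //= eqxx mulr1 -shifted_varE.
  rewrite big1 ?addr0 // => j /negPf.
  by rewrite -val_eqE /= => ->; rewrite mulr0.
elim/mpolyind: a => [|c m p _ _ IHp]; first exact: (goodC 0).
rewrite -/(good _) /good rmorphD /= opprD addrACA; apply: (idD _ _ _ IHp).
rewrite -/(good _) -mul_mpolyC; apply: (goodM) => //.
rewrite mpolyXE_id.
elim/big_ind: _ => [|x y|i _]; [exact: (goodC 1) | exact: goodM |].
by elim: (m i) => [|e IHe]; [exact: (goodC 1) | rewrite exprS; apply: (goodM)].
Qed.

Lemma shifted_var_regular : regular_seq shifted_var N.
Proof.
move=> k ltkN x /(in_idealP _ (ltnW ltkN)); rewrite rmorphM /=.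
rewrite (partial_eval_var (Ordinal ltkN)) ltnn.
by move/shifted_var_lreg => x0; apply/(in_idealP _ (ltnW ltkN)).
Qed.

Lemma in_ideal_eval (a : A) : in_ideal shifted_var N a <-> a.@[t] = 0.
Proof.
have evalE : partial_eval N a = (a.@[t])%:MP.
  elim/mpolyind: a => [|c m p _ _ IHp]; first by rewrite !rmorph0.
  rewrite !rmorphD /= IHp; congr (_ + _).
  rewrite -mul_mpolyC !rmorphM /= partial_evalC mevalC; congr (_ * _).
  rewrite mpolyXE_id !rmorph_prod; apply: eq_bigr => i _.
  by rewrite !rmorphXn /= partial_evalX ltn_ord mevalXU.
rewrite in_idealP // evalE; split=> [/eqP|->]; last by rewrite mpolyC0.
by rewrite mpolyC_eq0 => /eqP.
Qed.

End ShiftedVariables.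

(** * Normal forms modulo an ideal over a field *)

Section NormalForm.
Variables (K : fieldType) (N : nat) (Q : comNzRingType).
Local Notation R := {mpoly K[N]}.
Variable pi : {rmorphism R -> Q}.

(** The monomials outside the initial ideal of the kernel of [pi]; their images
    form a basis of the quotient. *)
Definition standard (m : 'X_{1..N}) : Prop :=
  forall p : R, pi p = 0 -> p != 0 -> mlead p != m.

(** Division by the whole ideal: a leading monomial is moved to the remainder
    when it is standard and cancelled otherwise; the monomial order is
    well-founded. *)
Lemma normal_form_exists (p : R) :
  exists r : R, pi r = pi p /\ forall m, m \in msupp r -> standard m.
Proof.
have drop_lead (q : R) m (c : K) : (mlead q <= m)%O -> c = q@_m ->
    q - c *: 'X_[m] = 0 \/ (mlead (q - c *: 'X_[m]) < m)%O.
  move=> leqm cE; case: (eqVneq (q - c *: 'X_[m]) 0) => [|nz]; first by left.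
  right; rewrite lt_neqAle; apply/andP; split.
    apply: contraNneq nz => lead_m.
    rewrite -mleadc_eq0 lead_m mcoeffB mcoeffZ mcoeffX eqxx mulr1 cE.
    by rewrite subrr.
  rewrite (le_trans (mleadB_le _ _)) // leUx leqm /=.
  by rewrite (le_trans (mleadZ_le _ _)) // mleadXm.
have [m le_pm] : exists m, (mlead p <= m)%O by exists (mlead p).
elim/(well_founded_ind (@ltom_wf N)): m p le_pm => m IHm p le_pm.
have std0 : forall k, k \in msupp (0 : R) -> standard k.
  by move=> k; rewrite msupp0.
have reduce (q : R) : q = 0 \/ (mlead q < m)%O ->
    exists r : R, pi r = pi q /\ forall k, k \in msupp r -> standard k.
  by case=> [->|ltqm]; [exists 0 | apply: IHm ltqm _ _].
case: (pselect (standard m)) => [std_m|].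
  have [r [rE r_std]] := reduce _ (drop_lead _ _ _ le_pm erefl).
  exists (r + p@_m *: 'X_[m]); split.
    by rewrite rmorphD rE -rmorphD subrK.
  move=> k /msuppD_le; rewrite mem_cat => /orP[/r_std //|].
  by move/msuppZ_le/mem_msuppXP <-.
move=> /existsNP[q /not_implyP[q0 /not_implyP[q_neq0 /negP]]].
rewrite negbK => /eqP q_lead.
pose c := p@_m / mleadc q.
have lcq : mleadc q != 0 by rewrite mleadc_eq0.
have [|r [rE r_std]] := reduce (p - c *: q); last first.
- exists r; split=> //; rewrite rE rmorphB -mul_mpolyC rmorphM q0 mulr0.
  by rewrite subr0.
case: (eqVneq (p - c *: q) 0) => [|nz]; first by left.
right; rewrite lt_neqAle; apply/andP; split.
  apply: contraNneq nz => lead_m.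
  rewrite -mleadc_eq0 lead_m mcoeffB mcoeffZ -{2}q_lead /c divfK //.
  by rewrite subrr.
rewrite (le_trans (mleadB_le _ _)) // leUx le_pm /=.
by rewrite (le_trans (mleadZ_le _ _)) // q_lead.
Qed.

Lemma normal_form_unique (r s : R) :
    (forall m, m \in msupp r -> standard m) ->
    (forall m, m \in msupp s -> standard m) ->
  pi r = pi s -> r = s.
Proof.
move=> r_std s_std rs; apply/eqP; rewrite -subr_eq0; apply/negPn/negP => nz.
have pi0 : pi (r - s) = 0 by rewrite rmorphB rs subrr.
have := mlead_supp nz; move/msuppB_le; rewrite mem_cat => /orP[/r_std|/s_std].
  by move/(_ _ pi0 nz); rewrite eqxx.
by move/(_ _ pi0 nz); rewrite eqxx.
Qed.

(** The quotient ring is free over the ground field, in the form in which it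
    is used: the normal form is linear because it is unique. *)
Lemma linear_section : surjective pi ->
  exists s : Q -> R, [/\ forall x, pi (s x) = x, {morph s : x y / x + y} &
    forall c x, s (pi c%:MP * x) = c *: s x].
Proof.
move=> pi_surj.
have /choice[s sP] : forall x, exists r : R,
    pi r = x /\ forall m, m \in msupp r -> standard m.
  by move=> x; have [p <-] := pi_surj x; apply: normal_form_exists.
have piE x : pi (s x) = x by case: (sP x).
have sE r x : (forall m, m \in msupp r -> standard m) -> pi r = x -> s x = r.
  move=> r_std <-; apply: normal_form_unique => //; by case: (sP (pi r)).
exists s; split=> // [x y|c x]; apply: sE.
- move=> m /msuppD_le; rewrite mem_cat; case: (sP x) (sP y) => _ hx [_ hy].
  by case/orP=> [/hx|/hy].
- by rewrite rmorphD !piE.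
- by move=> m /msuppZ_le; case: (sP x) => _; apply.
- by rewrite -mul_mpolyC rmorphM piE.
Qed.

End NormalForm.

Section CoefficientwiseSum.
Variables (N : nat) (S : nzRingType) (W : zmodType).
Variables (g : 'X_{1..N} -> S -> W).
Hypothesis g_add : forall m, {morph g m : x y / x + y}.

(** The additive extension of a family of maps given on the terms [c X^m]. *)
Definition mcoef_sum (p : {mpoly S[N]}) : W := \sum_(m <- msupp p) g m p@_m.

Let g0 m : g m 0 = 0.
Proof. by apply: (addrI (g m 0)); rewrite -g_add !addr0. Qed.

Lemma mcoef_sum_sub (p : {mpoly S[N]}) (r : seq 'X_{1..N}) :
  uniq r -> {subset msupp p <= r} -> mcoef_sum p = \sum_(m <- r) g m p@_m.
Proof.
move=> r_uniq sub; rewrite [RHS](bigID (mem (msupp p))) /=.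
rewrite [X in _ + X]big1 ?addr0 => [|m /memN_msupp_eq0->]; last exact: g0.
rewrite -big_filter; apply: perm_big; apply: uniq_perm.
- exact: msupp_uniq.
- exact: filter_uniq.
by move=> m; rewrite mem_filter; case: (boolP (m \in msupp p)) => // /sub->.
Qed.

Lemma mcoef_sumD : {morph mcoef_sum : p q / p + q}.
Proof.
move=> p q; pose r := undup (msupp p ++ msupp q).
have r_uniq : uniq r by apply: undup_uniq.
rewrite (mcoef_sum_sub r_uniq (p := p)) => [|m]; last first.
  by rewrite mem_undup mem_cat => ->.
rewrite (mcoef_sum_sub r_uniq (p := q)) => [|m]; last first.
  by rewrite mem_undup mem_cat orbC => ->.
rewrite (mcoef_sum_sub r_uniq) => [|m /msuppD_le]; last by rewrite mem_undup.
by rewrite -big_split; apply: eq_bigr => m _; rewrite mcoeffD g_add.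
Qed.

Lemma mcoef_sum_term c m : mcoef_sum (c *: 'X_[m]) = g m c.
Proof.
rewrite (mcoef_sum_sub (r := [:: m])) => // [|k /msuppZ_le]; last first.
  by rewrite msuppX.
by rewrite big_seq1 mcoeffZ mcoeffX eqxx mulr1.
Qed.

End CoefficientwiseSum.

(** * Base change to a quotient ring *)

Section BaseChange.
Variables (K : fieldType) (N : nat) (Q : comNzRingType).
Local Notation R := {mpoly K[N]}.
Local Notation A := {mpoly Q[N]}.
Variable pi : {rmorphism R -> Q}.

Definition base_change : {rmorphism R -> A} :=
  map_mpoly (pi \o @mpolyC N K).

Local Notation iota := base_change.

Lemma base_changeX m : iota 'X_[m] = 'X_[m].
Proof. exact: map_mpolyX. Qed.

Lemma base_changeC c : iota c%:MP = (pi c%:MP)%:MP.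
Proof. exact: map_mpolyC. Qed.

Lemma base_change_eval p : (iota p).@[fun i => pi 'X_i] = pi p.
Proof.
elim/mpolyind: p => [|c m p _ _ IHp]; first by rewrite !rmorph0.
rewrite !rmorphD /= IHp; congr (_ + _).
rewrite -mul_mpolyC !rmorphM base_changeC base_changeX /= mevalC.
congr (_ * _); rewrite mevalX mpolyXE_id rmorph_prod.
by apply: eq_bigr => i _; rewrite rmorphXn.
Qed.

Lemma base_change_scale p (a : restr iota A^o) : p *: a = iota p * (a : A).
Proof. by []. Qed.

(** [A] is free over [R], on a basis of [Q] over [K].  A linear map out of [A]
    is determined by its values on the images in [Q] of the monomials [X^m];
    these values are lifted arbitrarily (the family [b]), extended to [Q]
    linearly over [K] by means of normal forms (the map [g]) and then to [A]
    linearly over [R] (the map [h]). *)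
Lemma projective_base_change : surjective pi -> projective (restr iota A^o).
Proof.
move=> pi_surj B C e f e_surj.
have [s [sK sD sZ]] := linear_section pi_surj.
have /choice[b bE] : forall m : 'X_{1..N}, exists x : B,
    e x = f ((pi 'X_[m])%:MP) by move=> m; apply: e_surj.
pose g (q : Q) := mcoef_sum (fun m (c : K) => c%:MP *: b m : B) (s q).
have gD : {morph g : x y / x + y}.
  move=> x y; rewrite /g sD mcoef_sumD // => m c d.
  by rewrite mpolyCD scalerDl.
have gZ c x : g (pi c%:MP * x) = c%:MP *: g x.
  have addK m : {morph (fun d : K => d%:MP *: b m : B) : d d' / d + d'}.
    by move=> d d'; rewrite mpolyCD scalerDl.
  rewrite /g sZ (mcoef_sum_sub addK (msupp_uniq (s x))); last exact: msuppZ_le.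
  rewrite scaler_sumr; apply: eq_bigr => m _.
  by rewrite mcoeffZ mpolyCM scalerA.
have eg x : e (g x) = f (x%:MP).
  rewrite -[in RHS](sK x) [in RHS](mpolyE (s x)) /g /mcoef_sum linear_sum.
  rewrite rmorph_sum (rmorph_sum (@mpolyC N Q)) (linear_sum f).
  apply: eq_bigr => m _.
  rewrite linearZ bE -linearZ; congr (f _).
  by rewrite base_change_scale base_changeC -mul_mpolyC rmorphM /= mpolyCM.
pose h (a : A) := mcoef_sum (fun m q => 'X_[m] *: g q : B) a.
have hD : {morph h : x y / x + y}.
  by apply: mcoef_sumD => m x y; rewrite gD scalerDr.
have hX q m : h (q *: 'X_[m]) = 'X_[m] *: g q.
  by rewrite /h mcoef_sum_term // => k x y; rewrite gD scalerDr.
have h0 : h 0 = 0 by apply: (addrI (h 0)); rewrite -hD !addr0.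
have hZ p a : h (iota p * a) = p *: h a.
  elim/mpolyind: p a => [|c m p _ _ IHp] a.
    by rewrite rmorph0 mul0r h0 scale0r.
  rewrite rmorphD mulrDl hD IHp scalerDl; congr (_ + _).
  elim/mpolyind: a => [|q k a _ _ IHa]; first by rewrite mulr0 h0 scaler0.
  rewrite mulrDr hD IHa hD scalerDr; congr (_ + _).
  rewrite -mul_mpolyC rmorphM base_changeC base_changeX -mulrA.
  rewrite [in LHS]mul_mpolyC -scalerAr -mpolyXD scalerA !hX gZ !scalerA.
  by congr (_ *: _); rewrite mpolyXD mulrC mulrA.
have h_lin : linear (h : restr iota A^o -> B).
  by move=> p x y; rewrite base_change_scale hD hZ.
exists (mklin h_lin) => a /=.
elim/mpolyind: a => [|q k a _ _ IHa]; first by rewrite h0 !linear0.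
rewrite hD linearD IHa linearD; congr (_ + _).
rewrite hX linearZ eg -linearZ; congr (f _).
by rewrite base_change_scale base_changeX mulrC mul_mpolyC.
Qed.

End BaseChange.

(** * Projective dimension of cyclic modules with a socle *)

(** The quotient by the annihilator of the generator, a proper ideal. *)
Lemma cyclic_quotient_ring (R : comNzRingType) (M : lmodType R) (u : M) :
    u != 0 ->
  exists (Q : comNzRingType) (pi : {rmorphism R -> Q}),
    surjective pi /\ forall p, pi p = 0 <-> p *: u = 0.
Proof.
move=> u_neq0; pose ann : {pred R} := fun p => p *: u == 0.
have ann_ideal : idealr_closed ann.
  split; rewrite ?unfold_in ?scale0r ?scale1r //.
  move=> a x y; rewrite !unfold_in => /eqP x0 /eqP y0.
  by rewrite scalerDl -scalerA x0 y0 scaler0 addr0.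
pose I : idealr R := HB.pack_for (idealr R) (ann : R -> bool)
  (isIdealr.Build R ann ann_ideal).
exists {ideal_quot I}, (\pi_{ideal_quot I} : {rmorphism R -> {ideal_quot I}}).
split=> [x|p]; first by exists (repr x); apply: reprK.
rewrite -(rmorph0 (\pi_{ideal_quot I} : {rmorphism R -> {ideal_quot I}})).
split=> [/eqP|pu0].
  by rewrite -Quotient.idealrBE subr0 => /eqP.
by apply/eqP; rewrite -Quotient.idealrBE subr0; apply/eqP.
Qed.

Section Cyclic.
Variables (K : fieldType) (N : nat).
Local Notation R := {mpoly K[N]}.
Variables (M : lmodType R) (u : M).
Hypothesis u_gen : forall x : M, exists p : R, p *: u = x.
Variables (Q : comNzRingType) (pi : {rmorphism R -> Q}).
Hypothesis pi_surj : surjective pi.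
Hypothesis pi_ker : forall p, pi p = 0 <-> p *: u = 0.

Local Notation A := {mpoly Q[N]}.
Local Notation iota := (base_change pi).
Local Notation t := (fun i => pi 'X_i).
Local Notation KC := (koszul (shifted_var t) N).

Let pi_eq p q : pi p = pi q -> p *: u = q *: u.
Proof.
move=> pq; apply/eqP; rewrite -subr_eq0 -scalerBl; apply/eqP/pi_ker.
by rewrite rmorphB pq subrr.
Qed.

Lemma cyclic_iso : exists theta : Q -> M, forall p, theta (pi p) = p *: u.
Proof.
have /choice[s sK] := pi_surj.
by exists (fun x => s x *: u) => p; apply: pi_eq.
Qed.

Lemma koszul_augmentation :
  exists aug : {linear restr iota (chain_mod KC 0) -> M},
    surjective aug /\ forall a, aug a = 0 <->
      in_ideal (shifted_var t) N (degree0_out (shifted_var t) N a).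
Proof.
have [theta thetaE] := cyclic_iso.
pose ev (a : restr iota (chain_mod KC 0)) : Q :=
  meval t (degree0_out (shifted_var t) N a).
have lin_aug : linear (theta \o ev).
  move=> p a b /=; rewrite /ev.
  have [x xE] := pi_surj (ev a); have [y yE] := pi_surj (ev b).
  rewrite restrZ linearP mevalD mevalM base_change_eval -/(ev a) -/(ev b).
  by rewrite -xE -yE -rmorphM -rmorphD !thetaE scalerDl scalerA.
exists (mklin lin_aug); split=> [x|a] /=.
  have [p <-] := u_gen x; exists (degree0_in (shifted_var t) N (pi p)%:MP).
  by rewrite /ev degree0_inK mevalC thetaE.
rewrite in_ideal_eval -/(ev a); have [x <-] := pi_surj (ev a).
by rewrite thetaE pi_ker.
Qed.


Lemma koszul_aug_exact (aug : {linear restr iota (chain_mod KC 0) -> M}) :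
    (forall a, aug a = 0 <->
       in_ideal (shifted_var t) N (degree0_out (shifted_var t) N a)) ->
  forall x, aug x = 0 <-> exists y, restr_map iota (chain_diff KC 0) y = x.
Proof.
move=> augE x; split=> [/augE/koszul_im0[y yE]|[y yE]]; first by exists y.
by apply/augE/koszul_im0; exists y.
Qed.

Definition koszul_resolution (aug : {linear restr iota (chain_mod KC 0) -> M})
    (aug_surj : surjective aug)
    (aug_ker : forall a, aug a = 0 <->
       in_ideal (shifted_var t) N (degree0_out (shifted_var t) N a)) :
  proj_resolution M :=
  @ProjResolution R M (fun i => restr iota (chain_mod KC i))
    (fun i => restr_map iota (chain_diff KC i)) aug
    (fun i => @projective_koszul R A iota (shifted_var t) N i
                (projective_base_change pi_surj))
    aug_surj (koszul_aug_exact aug_ker)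
    (koszul_exact (@shifted_var_regular N Q t)).

(** A retraction is linear over [R], hence preserves membership in the submodule
    generated by the multiples of the variables.  The differential of the
    top-degree element [s] lies there because [t_i s = 0]; evaluating all
    variables at 0 then gives [s = 0]. *)
Lemma koszul_no_retraction (s : Q) n k : n = k.+1 -> (k < N)%N ->
    s != 0 -> (forall i, t i * s = 0) ->
    forall r : {linear restr iota (chain_mod (koszul (shifted_var t) n) k) ->
                       restr iota (chain_mod (koszul (shifted_var t) n) k.+1)},
  ~ (forall x, r (chain_diff (koszul (shifted_var t) n) k x) = x).
Proof.
move=> ->{n} ltkN s_neq0 ts0 r rK.
pose top := koszul_top (shifted_var t) k.+1 s%:MP.
have [c cE] : in_span (fun j => 'X_j)
    (chain_diff (koszul (shifted_var t) k.+1) k top).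
  apply: koszul_top_diff => i leik; pose j := Ordinal (leq_ltn_trans leik ltkN).
  exists j; rewrite -[i]/(val j) shifted_varE.
  rewrite -[LHS]/(('X_j - (t j)%:MP) * s%:MP) mulrBl -mpolyCM ts0 mpolyC0.
  exact: subr0.
have topE : top = \sum_j ('X_j : A) *: r (c j).
  rewrite -[LHS]rK cE.
  transitivity (r (\sum_j ('X_j : R) *: (c j : restr iota _))).
    congr (r _); apply: eq_bigr => j _.
    by rewrite -[RHS]/(iota 'X_j *: (c j : chain_mod _ _)) base_changeX.
  rewrite linear_sum; apply: eq_bigr => j _.
  rewrite linearZ -[LHS]/(iota 'X_j *: (r (c j) : chain_mod _ _)).
  by rewrite base_changeX.
case/negP: s_neq0; rewrite -(mevalC (fun _ : 'I_N => 0 : Q) s).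
rewrite -[s%:MP](koszul_topK (shifted_var t) k.+1) -/top topE linear_sum.
rewrite (raddf_sum (meval (fun _ : 'I_N => 0 : Q))) big1 // => j _.
by rewrite linearZ_LR [LHS](mevalM _ 'X_j _) mevalXU mul0r.
Qed.

End Cyclic.

(** Hilbert's syzygy theorem bounds the projective dimension by the number of
    variables; depth 0, witnessed by the socle element [s], makes the bound
    sharp. *)
Lemma is_pd_cyclic (K : fieldType) (N : nat) (M : lmodType {mpoly K[N]})
    (u s : M) :
    (forall x : M, exists p : {mpoly K[N]}, p *: u = x) ->
    s != 0 -> (forall i : 'I_N, ('X_i : {mpoly K[N]}) *: s = 0) ->
  is_pd M N.
Proof.
move=> u_gen s_neq0 s_socle.
have u_neq0 : u != 0.
  apply: contraNneq s_neq0 => u0; have [p <-] := u_gen s.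
  by rewrite u0 scaler0.
have [Q [pi [pi_surj pi_ker]]] := cyclic_quotient_ring u_neq0.
have [aug [aug_surj aug_ker]] := koszul_augmentation u_gen pi_surj pi_ker.
pose F := koszul_resolution pi_surj aug_surj aug_ker.
split; first by exists F => i ltNi x; apply: (koszul_vanish ltNi).
move=> q [P Pq]; rewrite leqNgt; apply/negP => ltqN.
have [p pE] := u_gen s.
have ps0 : pi p != 0.
  by apply: contra_neq s_neq0 => /pi_ker; rewrite pE.
have tps0 i : pi 'X_i * pi p = 0.
  by rewrite -rmorphM; apply/pi_ker; rewrite -scalerA pE.
(* [P] is too short, so the last Koszul differential has a retraction. *)
have N_eq : N = N.-1.+1 by rewrite (ltn_predK ltqN).
have [|x|r rK] := @retraction_of_short_resolution _ _ F P N.-1.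
- move=> x /(koszul_exact (@shifted_var_regular N Q _))[y <-].
  rewrite (koszul_vanish _ y) ?linear0 //; by rewrite -N_eq.
- by apply: Pq; rewrite -N_eq.
apply: (koszul_no_retraction N_eq _ ps0 tps0 rK).
by rewrite -N_eq.
Qed.

(** * The socle element *)

Section IdealMembership.
Variables (R : comNzRingType) (G : R -> Prop).
Local Notation I := (gen_ideal G).

Lemma gen_idealMl (a p : R) : p \in I -> a * p \in I.
Proof. by move=> Ip; have := @rpredZ R R^o (gen_ideal G) a p Ip. Qed.

Lemma gen_ideal_gen p : G p -> p \in I.
Proof.
move=> Gp; apply/asboolP; exists [:: (1, p)].
rewrite big_seq1 mul1r; split=> //.
by move=> q; rewrite inE => /eqP->.
Qed.

Lemma gen_ideal_sum1 (J : finType) (P : pred J) (F : J -> R) i0 : P i0 ->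
    (forall i, P i -> i != i0 -> F i \in I) ->
  (\sum_(i | P i) F i \in I) = (F i0 \in I).
Proof.
move=> Pi0 IF; rewrite (bigD1 i0) //=; apply: (@rpredDr R^o).
by apply: (@rpred_sum R^o) => i /andP[]; apply: IF.
Qed.

Lemma gen_ideal_ind (J : R -> Prop) :
    J 0 -> (forall p q, J p -> J q -> J (p + q)) ->
    (forall a p, G p -> J (a * p)) ->
  forall p, p \in I -> J p.
Proof.
move=> J0 JD JM p /asboolP[s [Gs ->]]; elim: s Gs => [|q s IHs] Gs.
  by rewrite big_nil.
rewrite big_cons; apply: JD; first by apply/JM/Gs; rewrite mem_head.
by apply: IHs => r rs; apply: Gs; rewrite inE rs orbT.
Qed.

End IdealMembership.

(** In the first column where the matrices differ, the equality of the column
    sums forces each of them to exceed the other somewhere. *)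
Lemma first_excess (g n : nat) (E F : 'I_g -> 'I_n -> nat) (k : nat) :
    (forall c : 'I_n, (c <= k)%N -> (\sum_j E j c = \sum_j F j c)%N) ->
    (exists c : 'I_n, exists j, (c <= k)%N /\ E j c <> F j c) ->
  exists c : 'I_n, exists j, [/\ (c <= k)%N,
    forall (c' : 'I_n) j', (c' < c)%N -> E j' c' = F j' c' & (E j c < F j c)%N].
Proof.
move=> sumEF [c0 [j0 [lec0k /eqP neq0]]].
pose differs (c : 'I_n) := (c <= k)%N && [exists j, E j c != F j c].
have dc0 : differs c0 by rewrite /differs lec0k; apply/existsP; exists j0.
case: (arg_minnP (fun c : 'I_n => c : nat) dc0) => c.
case/andP=> leck /existsP[j dj] c_min.
exists c; have [j' ltj'] : exists j, (E j c < F j c)%N.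
  case: (boolP [exists j, (E j c < F j c)%N]) => [/existsP //|].
  rewrite negb_exists => /forallP leFE.
  have le_j i : (F i c <= E i c)%N by rewrite leqNgt; apply: leFE.
  have [_ /esym eqEF] := leqif_sum (fun i (_ : true) => leqif_eq (le_j i)).
  rewrite sumEF // eqxx in eqEF; move/forallP: eqEF => /(_ j) /=.
  by rewrite eq_sym (negPf dj).
exists j'; split=> // c' i ltc'c; apply/eqP/negPn/negP => dc'.
have: differs c'.
  by rewrite /differs (leq_trans (ltnW ltc'c) leck); apply/existsP; exists i.
by move/c_min; rewrite leqNgt ltc'c.
Qed.

Definition single (g n : nat) (j : 'I_g) (c : 'I_n) (e : nat) j' c' : nat :=
  if (j' == j) && (c' == c) then e else 0%N.

Lemma prod_single (R : comNzRingType) (g n : nat) (x : 'I_g -> 'I_n -> R)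
    j c e :
  \prod_j' \prod_c' x j' c' ^+ single j c e j' c' = x j c ^+ e.
Proof.
rewrite (bigD1 j) //= (bigD1 c) //= /single !eqxx /=.
rewrite big1 ?mulr1 => [|c' /negPf->]; last by rewrite expr0.
rewrite big1 ?mulr1 // => j' /negPf->.
by rewrite big1 // => c' _; rewrite expr0.
Qed.

Section Socle.
Variables (K : fieldType) (g n : nat) (m : nat -> nat).
Local Notation R := (polyR g n m K).
Local Notation I := (gen_ideal (Igens (g := g) (n := n) (m := m) (K := K))).
Local Notation x := (xvar m K).
Local Notation expo := ('I_g -> 'I_n -> nat).

Definition mon (E : expo) : R := \prod_(j < g) \prod_(c < n) x j c ^+ E j c.

Lemma eq_mon (E F : expo) : (forall j c, E j c = F j c) -> mon E = mon F.
Proof.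
by move=> EF; apply: eq_bigr => j _; apply: eq_bigr => c _; rewrite EF.
Qed.

Lemma monD (E F : expo) : mon (fun j c => E j c + F j c)%N = mon E * mon F.
Proof.
rewrite -big_split; apply: eq_bigr => j _; rewrite -big_split.
by apply: eq_bigr => c _; rewrite /= exprD.
Qed.

Lemma monB (E F : expo) : (forall j c, F j c <= E j c)%N ->
  mon E = mon (fun j c => E j c - F j c)%N * mon F.
Proof. by move=> leFE; rewrite -monD; apply: eq_mon => j c; rewrite subnK. Qed.

Lemma mon_single j c e : mon (single j c e) = x j c ^+ e.
Proof. exact: prod_single. Qed.

(** With columns counted from 0, [top_expo k] is [d_{k+1} - 1]. *)
Definition top_expo (k : nat) : nat := (\sum_(k.+1 <= i < n.+1) m i)%N.

Lemma dexpE k : dexp n m k.+1 = (top_expo k).+1.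
Proof. by rewrite /dexp addn1. Qed.

Lemma topS k : (k < n)%N -> top_expo k = (m k.+1 + top_expo k.+1)%N.
Proof. by move=> ltkn; rewrite /top_expo big_ltn. Qed.

Lemma m_le_top k : (k < n)%N -> (m k.+1 <= top_expo k)%N.
Proof. by move/topS->; apply: leq_addr. Qed.

(** What the exponent matrices of all the terms of [f] have in common: columns
    up to [k] have the prescribed sums, and columns before [k] are bounded as
    in the matrices of the sets [calA]. *)
Definition profile (k : nat) (E : expo) : Prop :=
  (forall c : 'I_n, (c <= k)%N -> (\sum_j E j c = m c.+1)%N) /\
  (forall (c : 'I_n) j, (c < k)%N -> (E j c < m c.+1)%N).

Definition beyond_top (c : 'I_n) : Prop := forall j (E : expo),
  (forall j' (c' : 'I_n), (c' < c)%N -> (top_expo c' <= E j' c')%N) ->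
  (top_expo c < E j c)%N -> mon E \in I.

Definition trunc_top (k : nat) : expo :=
  fun _ c => if (c <= k)%N then top_expo c else 0%N.

Lemma profile_le_top k E j (c : 'I_n) :
  profile k E -> (c <= k)%N -> (E j c <= top_expo c)%N.
Proof.
case=> sumE _ leck; rewrite (leq_trans _ (m_le_top (ltn_ord c))) //.
by rewrite -(sumE c leck) (bigD1 j) //= leq_addr.
Qed.

(** This is why all but one of the terms of [h * f] lie in the ideal, when [h]
    is chosen so as to complete [X^E] to the truncated top monomial: in the
    first column where [F] differs from [E], some exponent goes beyond the top
    one, while all earlier columns are at the top. *)
Lemma differing_term k k' (E F : expo) (q : R) :
    (forall c : 'I_n, (c <= k)%N -> beyond_top c) ->
    profile k E -> (forall j (c : 'I_n), (k < c)%N -> E j c = 0%N) ->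
    profile k' F ->
    (exists c : 'I_n, exists j,
       [/\ (c <= k)%N, (c <= k')%N & E j c <> F j c]) ->
  mon (fun j c => trunc_top k j c - E j c)%N * (mon F * q) \in I.
Proof.
move=> claim profE E0 profF [c0 [j0 [lec0k lec0k' neq0]]].
have [||c [j [lec eq_lt gt_c]]] := @first_excess g n E F (minn k k').
- by move=> c; rewrite leq_min => /andP[ck ck']; rewrite profE.1 ?profF.1.
- by exists c0, j0; rewrite leq_min lec0k.
rewrite leq_min in lec; case/andP: lec => leck leck'.
rewrite mulrA mulrC; apply: gen_idealMl; rewrite -monD.
apply: (claim c leck j) => [j' c' ltc'c|].
  have lec'k := leq_trans (ltnW ltc'c) leck.
  rewrite -(eq_lt _ j' ltc'c) /trunc_top lec'k subnK //.
  exact: profile_le_top profE lec'k.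
rewrite /trunc_top leck addnBAC ?(profile_le_top _ profE) //.
rewrite ltn_subRL addnC -addnS leq_add2l. exact: gt_c.
Qed.

Hypothesis hg : (2 <= g)%N.
Hypothesis m_pos : forall k, (k.+1 < n)%N -> (0 < m k.+1)%N.
Hypothesis m_ge2 : forall k, (k.+2 < n)%N -> (1 < m k.+1)%N.

Definition expo_of (A : expmx g n m) : expo := fun j c => A j c.

Lemma calAP k (A : expmx g n m) : A \in calA g n m k ->
  [/\ forall (c : 'I_n) j, (c < k)%N -> (A j c <= Mbound n m c.+1)%N,
      forall c : 'I_n, (c < k)%N -> (\sum_j A j c = m c.+1)%N &
      forall (c : 'I_n) j, (k <= c)%N -> A j c = 0%N :> nat].
Proof.
rewrite inE => /forallP A_ok; split=> [c j ltck|c ltck|c j lekc].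
- by have := A_ok c; rewrite ltck => /andP[/forallP].
- by have := A_ok c; rewrite ltck => /andP[_ /eqP].
- by have := A_ok c; rewrite ltnNge lekc /= => /forallP/(_ j)/eqP.
Qed.

Lemma Mbound_lt k : (k.+1 < n)%N -> (Mbound n m k.+1 < m k.+1)%N.
Proof.
move=> ltkn; rewrite /Mbound ltn_eqF // subn1 prednK //; exact: m_pos.
Qed.

Lemma profile_spike (c : 'I_n) j (A : expmx g n m) :
    (c.+1 < n)%N -> A \in calA g n m c ->
  profile c (fun j' c' => expo_of A j' c' + single j c (m c.+1) j' c')%N.
Proof.
move=> ltcn /calAP[A_small A_sum A0]; split=> [c' lec'c|c' j' ltc'c].
  rewrite big_split /=; have [ltc'c|lecc'] := ltnP c' c.
    rewrite A_sum // big1 ?addn0 // => j' _.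
    by rewrite /single -[c' == c]val_eqE ltn_eqF // andbF.
  have -> : c' = c by apply: val_inj; apply/eqP; rewrite eqn_leq lec'c.
  rewrite big1 => [|j' _]; last exact: A0.
  rewrite (bigD1 j) //= /single !eqxx big1 ?addn0 // => j' /negPf->.
  by [].
rewrite /single -[c' == c]val_eqE (ltn_eqF ltc'c) andbF addn0.
apply: leq_ltn_trans (A_small c' j' ltc'c) (Mbound_lt _).
exact: leq_ltn_trans ltc'c (ltnW ltcn).
Qed.

Lemma profile_last (B : expmx g n m) : B \in calA g n m n ->
  profile n.-1 (expo_of B).
Proof.
move=> /calAP[B_small B_sum _]; split=> [c _|c j ltcn].
  exact: B_sum.
apply: leq_ltn_trans (B_small c j (ltn_ord c)) (Mbound_lt _).
by rewrite -ltn_predRL.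
Qed.

(** Two rows and [m_i >= 2] leave room for the columns
    [(m_i - 1, 1, 0, ..., 0)]. *)
Lemma calA_nonempty (k : nat) : (k.+1 < n)%N -> exists A, A \in calA g n m k.
Proof.
move=> ltkn; pose M := (\max_(1 <= i < n.+1) m i)%N.
pose e (j : 'I_g) (c : 'I_n) : nat :=
  if (c < k)%N then
    if j == 0%N :> nat then (m c.+1).-1
    else if j == 1%N :> nat then 1%N else 0%N
  else 0%N.
have leM (c : 'I_n) : (m c.+1 <= M)%N.
  rewrite /M; apply: (@leq_bigmax_seq _ _ _ m c.+1) => //.
  by rewrite mem_index_iota /= ltnS ltn_ord.
have e_small j (c : 'I_n) : (c < k)%N -> (e j c <= (m c.+1).-1)%N.
  move=> ltck; have := m_ge2 (leq_ltn_trans (ltck : (c.+1 < k.+1)%N) ltkn).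
  by rewrite /e ltck; case: ifP => _ //; case: ifP => _; lia.
have e_leM j c : (e j c < M.+1)%N.
  case: (ltnP c k) => [ltck|lekc].
    by rewrite ltnS (leq_trans (e_small j c ltck)) // (leq_trans (leq_pred _)).
  by rewrite /e (leq_gtF lekc).
pose A : expmx g n m := \matrix_(j, c) inord (e j c).
exists A; rewrite inE; apply/forallP => c.
have eE j : A j c = e j c :> nat by rewrite mxE inordK.
case: ifP => [ltck|lekc]; last first.
  by apply/forallP => j; rewrite eE /e -[(c < k)%N]/(c.+1 <= k)%N lekc.
apply/andP; split.
  apply/forallP => j; rewrite eE (leq_trans (e_small j c ltck)) //.
  by rewrite /Mbound subn1; case: ifP => // _; apply: leq_pred.
apply/eqP; transitivity (\sum_j e j c)%N.
  by apply: eq_bigr => j _; apply: eE.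
have g0 : (0 < g)%N by apply: ltnW.
rewrite (bigD1 (Ordinal g0)) //= (bigD1 (Ordinal hg)) //= /e ltck /=.
rewrite big1 => [|j /andP[/negPf j0 /negPf j1]].
  have := m_ge2 (leq_ltn_trans (ltck : (c.+1 < k.+1)%N) ltkn); lia.
by move: j0 j1; rewrite -!val_eqE /= => -> ->.
Qed.

Local Notation y := (@yvar g n m K).

(** The exponents of [X^A x_{j,k}^m_k]: the body [A] and the tip [(j, k)]. *)
Definition spike (A : expmx g n m) j (c : 'I_n) : expo :=
  fun j' c' => (expo_of A j' c' + single j c (m c.+1) j' c')%N.

Lemma mul_fpoly (h : R) : h * fpoly g n m K =
  \sum_(c < n) \sum_(c' < n | c' == c.+1 :> nat)
    \sum_(A in calA g n m c) \sum_(j < g)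
      h * (mon (spike A j c) * x j c' ^+ dexp n m c'.+1)
  + \sum_(B : {A : expmx g n m | A \in calA g n m n})
      h * (mon (expo_of (val B)) * y B).
Proof.
rewrite /fpoly mulrDr; congr (_ + _); rewrite mulr_sumr //.
apply: eq_bigr => c _.
rewrite mulr_sumr; apply: eq_bigr => c' _; rewrite mulr_sumr.
apply: eq_bigr => A _; rewrite mulr_sumr; apply: eq_bigr => j _.
by rewrite /spike monD mon_single.
Qed.

Lemma spike_at (A : expmx g n m) j (c : 'I_n) :
  A \in calA g n m c -> spike A j c j c = m c.+1.
Proof.
by move=> /calAP[_ _ A0]; rewrite /spike /expo_of A0 // /single !eqxx.
Qed.

Lemma spike_beyond (A : expmx g n m) j (c : 'I_n) j' (c' : 'I_n) :
  A \in calA g n m c -> (c < c')%N -> spike A j c j' c' = 0%N.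
Proof.
move=> /calAP[_ _ A0] ltcc'; rewrite /spike /expo_of A0 ?(ltnW ltcc') //.
by rewrite /single -[c' == c]val_eqE gtn_eqF // andbF.
Qed.

(** The tip of a spike has exponent [m_k], more than any entry of a column that
    belongs to a body. *)
Lemma spike_differs_small (A : expmx g n m) j (c : 'I_n) k (F : expo) :
    A \in calA g n m c -> profile k F -> (c < k)%N ->
  exists c0 : 'I_n, exists j0,
    [/\ (c0 <= c)%N, (c0 <= k)%N & spike A j c j0 c0 <> F j0 c0].
Proof.
move=> Ac profF ltck; exists c, j; split; rewrite ?(ltnW ltck) //.
by rewrite spike_at // => mF; have := profF.2 c j ltck; rewrite mF ltnn.
Qed.

Lemma differs_sym (k k' : nat) (E F : expo) :
    (exists c0 : 'I_n, exists j0,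
       [/\ (c0 <= k)%N, (c0 <= k')%N & E j0 c0 <> F j0 c0]) ->
  exists c0 : 'I_n, exists j0,
       [/\ (c0 <= k')%N, (c0 <= k)%N & F j0 c0 <> E j0 c0].
Proof.
by move=> [c0 [j0 [? ? neq]]]; exists c0, j0; split=> // FE; apply: neq.
Qed.

Lemma spike_differs_tip (A A' : expmx g n m) j j' (c : 'I_n) : (c.+1 < n)%N ->
    A \in calA g n m c -> A' \in calA g n m c -> j' != j ->
  exists c0 : 'I_n, exists j0,
    [/\ (c0 <= c)%N, (c0 <= c)%N & spike A j c j0 c0 <> spike A' j' c j0 c0].
Proof.
move=> ltcn Ac /calAP[_ _ A'0] /negPf neqj; exists c, j; split=> //.
rewrite spike_at // /spike /expo_of A'0 // /single eq_sym neqj /=.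
by have := m_pos ltcn; case: (m c.+1).
Qed.

Lemma expo_differs k (A A' : expmx g n m) : A \in calA g n m k ->
  A' \in calA g n m k -> A' != A ->
  exists c0 : 'I_n, exists j0, (c0 < k)%N /\ A j0 c0 <> A' j0 c0 :> nat.
Proof.
move=> /calAP[_ _ A0] /calAP[_ _ A'0] neqA.
case: (boolP [exists c0 : 'I_n, exists j0, A j0 c0 != A' j0 c0]).
  case/existsP=> c0 /existsP[j0 /eqP neq]; exists c0, j0.
  split; last by move/val_inj.
  rewrite ltnNge; apply/negP => lek; apply: neq; apply: val_inj.
  by rewrite /= A0 // A'0.
rewrite negb_exists => /forallP eqA; case/eqP: neqA; apply/matrixP => i c.
by have := eqA c; rewrite negb_exists => /forallP/(_ i); rewrite negbK => /eqP.
Qed.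

Lemma spike_differs_body (A A' : expmx g n m) j (c : 'I_n) :
    A \in calA g n m c -> A' \in calA g n m c -> A' != A ->
  exists c0 : 'I_n, exists j0,
    [/\ (c0 <= c)%N, (c0 <= c)%N & spike A j c j0 c0 <> spike A' j c j0 c0].
Proof.
move=> Ac A'c /(expo_differs Ac A'c)[c0 [j0 [ltc0 neq]]].
by exists c0, j0; split; rewrite ?(ltnW ltc0) // /spike /expo_of => /addIn.
Qed.

Lemma fpoly_in : fpoly g n m K \in I.
Proof. by apply: gen_ideal_gen; right. Qed.

Lemma single_le (E F : expo) (j : 'I_g) (c : 'I_n) e :
    (forall j' c', F j' c' <= E j' c')%N -> F j c = 0%N -> (e <= E j c)%N ->
  forall j' c', (F j' c' + single j c e j' c' <= E j' c')%N.
Proof.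
move=> leFE F0 le_e j' c'; rewrite /single.
case: (altP andP) => [[/eqP-> /eqP->]|_]; first by rewrite F0.
by rewrite addn0.
Qed.

(** By induction on the column.  In the first column this is the generator
    [x_{j,1}^d_1]; afterwards [f] is multiplied by the cofactor [h] of a spike
    with tip [(j, p)], [p] being the preceding column, in the top monomial of
    the columns up to [p]. *)
Lemma beyond_topP (c : 'I_n) : beyond_top c.
Proof.
have [k] := ubnP (c : nat); elim: k c => // k IHk c ltck j E E_top E_c.
case: c ltck E_top E_c => [[|c] ltcn] ltck E_top E_c.
  rewrite (@monB E (fun j' c' =>
    0 + single j (Ordinal ltcn) (top_expo 0).+1 j' c')%N).
    rewrite mon_single; apply: gen_idealMl; apply: gen_ideal_gen; left.
    by exists j, (Ordinal ltcn); rewrite dexpE.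
  by apply: (single_le (F := fun _ _ => 0%N)).
have [A Ac] := calA_nonempty ltcn.
pose p : 'I_n := Ordinal (ltnW ltcn).
have claim (c' : 'I_n) : (c' <= p)%N -> beyond_top c'.
  by move=> lec'; apply: IHk; apply: leq_ltn_trans lec' _.
have Ap : A \in calA g n m p by [].
have prof_spike A1 j1 (c1 : 'I_n) : (c1.+1 < n)%N -> A1 \in calA g n m c1 ->
  profile c1 (spike A1 j1 c1) by move=> ?; apply: profile_spike.
have profS := prof_spike A j p ltcn Ap.
have beyond j' (c' : 'I_n) : (p < c')%N -> spike A j p j' c' = 0%N.
  exact: spike_beyond.
(* The cofactor of the spike: [h * f] lies in the ideal, and so do all terms of
   [h * f] except the one coming from the spike itself. *)
pose h := mon (fun j' c' => trunc_top p j' c' - spike A j p j' c')%N.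
have term k' F q := @differing_term p k' (spike A j p) F q claim profS beyond.
have := gen_idealMl h fpoly_in; rewrite mul_fpoly.
rewrite (@rpredDr R^o) ; last first.
  apply: (@rpred_sum R^o) => B _.
  apply: (term _ _ _ (profile_last (valP B))).
  apply: spike_differs_small (profile_last (valP B)) _ => //.
  by rewrite ltn_predRL.
rewrite (gen_ideal_sum1 (i0 := p)) // => [|c1 _ neqc1]; last first.
  apply: (@rpred_sum R^o) => c' /eqP c'E.
  have ltc1n : (c1.+1 < n)%N by rewrite -c'E.
  apply: (@rpred_sum R^o) => A1 A1c; apply: (@rpred_sum R^o) => j1 _.
  have profF := prof_spike A1 j1 c1 ltc1n A1c.
  apply: (term _ _ _ profF).
  case: (ltngtP p c1) => [ltp|ltp|/val_inj eqp].
    exact: spike_differs_small.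
    by apply: differs_sym; apply: spike_differs_small.
  by rewrite eqp eqxx in neqc1.
rewrite (gen_ideal_sum1 (i0 := Ordinal ltcn)) //=; last first.
  by move=> c' /eqP c'E /negP[]; apply/eqP/val_inj.
rewrite (gen_ideal_sum1 (i0 := A)) // => [|A1 A1c neqA]; last first.
  apply: (@rpred_sum R^o) => j1 _.
  apply: (term _ _ _ (prof_spike A1 j1 p ltcn A1c)).
  case: (eqVneq j1 j) => [->|neqj]; first exact: spike_differs_body.
  exact: spike_differs_tip.
rewrite (gen_ideal_sum1 (i0 := j)) // => [|j1 _ neqj]; last first.
  apply: (term _ _ _ (prof_spike A j1 p ltcn Ap)).
  exact: spike_differs_tip.
rewrite mulrA /h -monB => [hx|j' c']; last first.
  rewrite /trunc_top; case: (leqP c' p) => [lec'|ltc']; last by rewrite beyond.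
  exact: profile_le_top profS lec'.
(* The isolated term divides [mon E]. *)
rewrite (@monB E (fun j' c' => trunc_top p j' c' +
  single j (Ordinal ltcn) (top_expo c.+1).+1 j' c')%N).
  by apply: gen_idealMl; rewrite monD mon_single -dexpE.
apply: single_le => // [j' c'|].
  by rewrite /trunc_top; case: (leqP c' p) => [lec'|_] //; apply: E_top.
by rewrite /trunc_top /= ltnn.
Qed.

Definition socle_mon : R := mon (fun _ c => top_expo c).

Lemma mul_xvar_socle j c : x j c * socle_mon \in I.
Proof.
rewrite -[x j c]expr1 -mon_single -monD; apply: (@beyond_topP c j).
  by move=> j' c' _; apply: leq_addl.
by rewrite /single !eqxx.
Qed.

Lemma le_predn (c : 'I_n) : (c <= n.-1)%N.
Proof. by rewrite -ltnS (leq_trans (ltn_ord c)) // leqSpred. Qed.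

Lemma mul_yvar_socle B : y B * socle_mon \in I.
Proof.
have profB := profile_last (valP B).
pose h := mon (fun j c => trunc_top n.-1 j c - expo_of (val B) j c)%N.
have claim (c : 'I_n) : (c <= n.-1)%N -> beyond_top c.
  by move=> _; apply: beyond_topP.
have beyond j' (c' : 'I_n) : (n.-1 < c')%N -> expo_of (val B) j' c' = 0%N.
  by rewrite ltnNge le_predn.
have term k' F q :=
  @differing_term n.-1 k' (expo_of (val B)) F q claim profB beyond.
have := gen_idealMl h fpoly_in; rewrite mul_fpoly addrC.
rewrite (@rpredDr R^o); last first.
  apply: (@rpred_sum R^o) => c1 _; apply: (@rpred_sum R^o) => c' /eqP c'E.
  have ltc1n : (c1.+1 < n)%N by rewrite -c'E.
  apply: (@rpred_sum R^o) => A1 A1c; apply: (@rpred_sum R^o) => j1 _.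
  apply: (term _ _ _ (profile_spike j1 ltc1n A1c)); apply: differs_sym.
  by apply: spike_differs_small profB _ => //; rewrite ltn_predRL.
rewrite (gen_ideal_sum1 (i0 := B)) // => [|B' _ neqB]; last first.
  apply: (term _ _ _ (profile_last (valP B'))).
  have [|||c0 [j0 [_ neq]]] := @expo_differs n (val B) (val B').
  - exact: valP.
  - exact: valP.
  - by rewrite val_eqE.
  by exists c0, j0; rewrite le_predn.
rewrite mulrA /h -monB => [|j' c']; last first.
  by rewrite /trunc_top le_predn; apply: profile_le_top profB (le_predn _).
suff -> : socle_mon = mon (trunc_top n.-1) by rewrite mulrC.
by apply: eq_mon => j c; rewrite /trunc_top le_predn.
Qed.

(** The monomials outside the monomial ideal generated by the [y_B] and the
    [x_{j,k}^d_k]. *)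
Definition below_top (a : 'X_{1..#|vars g n m|}) : Prop :=
  (forall j c, a (enum_rank (inl (j, c) : vars g n m)) <= top_expo c)%N /\
  (forall B, a (enum_rank (inr B : vars g n m)) = 0%N).

Definition vanishes_below (p : R) : Prop :=
  forall a, below_top a -> p@_a = 0.

Lemma vanishes_belowMX p i e : (forall a, below_top a -> (a i < e)%N) ->
  vanishes_below (p * 'X_i ^+ e).
Proof.
move=> i_lt a a_below; apply/eqP; rewrite mcoeff_eq0.
apply/negP; rewrite mpolyXn (perm_mem (msuppMX _ _)) => /mapP[b _ aE].
have := i_lt a a_below; rewrite aE mnmDE mulmnE mnm1E eqxx mul1n.
by rewrite ltnNge leq_addr.
Qed.

Lemma vanishes_below_xvar p j c : vanishes_below (p * x j c ^+ dexp n m c.+1).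
Proof. by apply: vanishes_belowMX => a [a_x _]; rewrite dexpE ltnS. Qed.

Lemma vanishes_belowD p q :
  vanishes_below p -> vanishes_below q -> vanishes_below (p + q).
Proof. by move=> p0 q0 a a_below; rewrite mcoeffD p0 ?q0 ?addr0. Qed.

Lemma vanishes_below_sum (J : Type) (r : seq J) (P : pred J) (F : J -> R) :
  (forall i, P i -> vanishes_below (F i)) ->
  vanishes_below (\sum_(i <- r | P i) F i).
Proof.
move=> F0; elim/big_ind: _ => //; first by move=> a _; rewrite mcoeff0.
exact: vanishes_belowD.
Qed.

(** Each term of [f] has a factor [y_B] or [x_{j,k+1}^d_{k+1}], so the
    generators lie in the monomial ideal. *)
Lemma ideal_vanishes_below p : p \in I -> vanishes_below p.
Proof.
apply: gen_ideal_ind => [a _||]; first by rewrite mcoeff0.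
  exact: vanishes_belowD.
move=> h q [[j [c [c0 ->]]]|->].
  by have := @vanishes_below_xvar h j c; rewrite c0.
rewrite mul_fpoly; apply: vanishes_belowD.
  apply: vanishes_below_sum => c _; apply: vanishes_below_sum => c' _.
  apply: vanishes_below_sum => A _; apply: vanishes_below_sum => j _.
  by rewrite mulrA; apply: vanishes_below_xvar.
apply: vanishes_below_sum => B _; rewrite mulrA -[y B]expr1.
by apply: vanishes_belowMX => a [_ ->].
Qed.

Lemma socle_notin : socle_mon \notin I.
Proof.
(* The exponent vector of [socle_mon], which is a monomial below the top. *)
pose a : 'X_{1..#|vars g n m|} := [multinom
  (if enum_val i is inl (_, c) then top_expo c else 0%N) | i < #|vars g n m|].
have a_below : below_top a by split=> *; rewrite mnmE enum_rankK.
apply/negP => /ideal_vanishes_below/(_ a a_below).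
suff -> : socle_mon = 'X_[a] by rewrite mcoeffX eqxx => /eqP; rewrite oner_eq0.
rewrite mpolyXE_id (reindex (@enum_rank (vars g n m))) /=; last first.
  by apply: onW_bij; apply: enum_rank_bij.
rewrite big_sumType /= [X in _ * X]big1 ?mulr1 => [|B _]; last first.
  by rewrite mnmE enum_rankK expr0.
rewrite /socle_mon /mon pair_bigA /=; apply: eq_bigr => -[j c] _.
by rewrite mnmE enum_rankK.
Qed.

End Socle.

(** * The number of variables *)

Section Counting.
Local Open Scope nat_scope.

Definition compositions (g L s : nat) : {set {ffun 'I_g -> 'I_L.+1}} :=
  [set v : {ffun 'I_g -> 'I_L.+1} | \sum_j v j == s].

Definition small_compositions (g L s : nat) : {set {ffun 'I_g -> 'I_L.+1}} :=
  [set v in compositions g L s | [forall j, v j < s]].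

Lemma compositionP g L s (v : {ffun 'I_g -> 'I_L.+1}) j :
  v \in compositions g L s -> v j <= s.
Proof. by rewrite inE => /eqP<-; rewrite (bigD1 j) //= leq_addr. Qed.

Lemma card_compositions g L s : 0 < g -> s <= L ->
  #|compositions g L s| = 'C(s + g.-1, s).
Proof.
case: g => // g _ lesL; rewrite /= addnC -bin_sub ?leq_addl // addnK.
rewrite -card_ord_partitions.
pose widen (t : g.+1.-tuple 'I_s.+1) : {ffun 'I_g.+1 -> 'I_L.+1} :=
  [ffun j => inord (tnth t j)].
have widenE t j : widen t j = tnth t j :> nat.
  by rewrite ffunE inordK // (leq_trans (ltn_ord _)).
have widen_inj : injective widen.
  move=> t t' /ffunP eqt; apply: eq_from_tnth => j; apply: val_inj => /=.
  by rewrite -!widenE eqt.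
rewrite -(card_imset _ widen_inj); apply: eq_card => v; rewrite inE.
apply/idP/imsetP => [sum_v|[t]].
  exists [tuple inord (v j) | j < g.+1].
    rewrite inE big_tuple; apply/eqP; rewrite -[RHS](eqP sum_v).
    apply: eq_bigr => j _.
    by rewrite tnth_mktuple inordK // ltnS (compositionP j) // inE sum_v.
  apply/ffunP => j; apply: val_inj; rewrite /= widenE tnth_mktuple inordK //.
  by rewrite ltnS (compositionP j) // inE.
rewrite inE big_tuple => /eqP sum_t ->; apply/eqP; rewrite -[RHS]sum_t.
by apply: eq_bigr => j _; apply: widenE.
Qed.

(** A part equal to [s] forces all the others to be 0. *)
Lemma card_small_compositions g L s : 0 < g -> 0 < s <= L ->
  #|small_compositions g L s| = 'C(s + g.-1, s) - g.
Proof.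
move=> g_gt0 /andP[s_gt0 lesL]; rewrite -(card_compositions g_gt0 lesL).
pose peak (i : 'I_g) : {ffun 'I_g -> 'I_L.+1} :=
  [ffun j => inord (if j == i then s else 0)].
have peakE i j : peak i j = (if j == i then s else 0) :> nat.
  by rewrite ffunE inordK //; case: ifP.
have peak_inj : injective peak.
  move=> i i' /ffunP/(_ i)/(congr1 (@nat_of_ord _)); rewrite !peakE eqxx.
  by case: eqP => // _ s0; rewrite s0 in s_gt0.
have peak_in i : peak i \in compositions g L s.
  rewrite inE (bigD1 i) //= peakE eqxx big1 ?addn0 // => j /negPf ji.
  by rewrite peakE ji.
transitivity (#|compositions g L s| - #|peak @: 'I_g|); last first.
  by rewrite card_imset // card_ord.
rewrite -cardsDS; last by apply/subsetP=> v /imsetP[i _ ->].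
apply: eq_card => v; rewrite !inE [RHS]andbC.
case: eqP => //= sum_v.
apply/forallP/negP => [v_small /imsetP[i _ vE]|not_peak j].
  by have := v_small i; rewrite vE peakE eqxx ltnn.
rewrite ltn_neqAle (compositionP j) ?inE ?sum_v // andbT.
apply/eqP => vj; case: not_peak; apply/imsetP; exists j => //.
apply/ffunP => i; apply: val_inj; rewrite /= peakE.
case: eqVneq => [-> //|neqij].
move: sum_v; rewrite (bigD1 j) //= vj -[X in _ = X]addn0 => /addnI/eqP.
by rewrite sum_nat_eq0 => /forallP/(_ i); rewrite neqij => /eqP.
Qed.

Lemma card_calA g n m : 0 < g ->
    (forall k, k.+1 < n -> 0 < m k.+1) ->
  #|calA g n m n| =
    \prod_(c < n) ('C(m c.+1 + g.-1, m c.+1) - (if c.+1 == n then 0 else g)).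
Proof.
move=> g_gt0 m_pos; set L := \max_(1 <= i < n.+1) m i.
have leL (c : 'I_n) : m c.+1 <= L.
  rewrite /L; apply: (@leq_bigmax_seq _ _ xpredT m c.+1) => //.
  by rewrite mem_index_iota /= ltnS; apply: ltn_ord.
pose S (c : 'I_n) := if c.+1 == n then compositions g L (m c.+1)
                     else small_compositions g L (m c.+1).
transitivity #|family S|.
  pose columns (A : expmx g n m) : {ffun 'I_n -> {ffun 'I_g -> 'I_L.+1}} :=
    [ffun c => [ffun j => A j c]].
  have columns_inj : injective columns.
    move=> A B /ffunP eqAB; apply/matrixP => j c.
    by have := eqAB c; rewrite !ffunE => /ffunP/(_ j); rewrite !ffunE.
  rewrite -(card_imset _ columns_inj); apply: eq_card => F.
  pose A : expmx g n m := (\matrix_(j, c) F c j)%R.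
  have -> : F = columns A.
    by apply/ffunP => c; apply/ffunP => j; rewrite !ffunE mxE.
  rewrite mem_imset // inE; apply: eq_forallb => c.
  rewrite ltn_ord ffunE -[RHS]/([ffun j => A j c] \in S c) /S.
  have sumE : \sum_j [ffun j => A j c] j = \sum_j A j c.
    by apply: eq_bigr => j _; rewrite ffunE.
  rewrite /Mbound; case: eqP => [c_last|/eqP c_last].
    rewrite inE sumE; case: eqP => [sumA|]; rewrite ?andbF // andbT.
    by apply/forallP => j; rewrite -sumA (bigD1 j) //= leq_addr.
  rewrite !inE sumE andbC; congr (_ && _); apply: eq_forallb => j.
  rewrite ffunE -ltnS subn1 prednK //; apply: m_pos.
  by rewrite ltn_neqAle c_last ltn_ord.
rewrite card_family foldrE big_image /=; apply: eq_bigr => c _; rewrite /S.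
case: eqP => [_|/eqP c_last]; first by rewrite subn0 card_compositions.
rewrite card_small_compositions // leL andbT; apply: m_pos.
by rewrite ltn_neqAle c_last ltn_ord.
Qed.

Lemma card_vars g n m : 0 < g -> 0 < n ->
    (forall k, k.+1 < n -> 0 < m k.+1) ->
  #|vars g n m| =
    (\prod_(1 <= i < n) ((m i + g - 1)`! %/ ((g - 1)`! * (m i)`!) - g))
    * ((m n + g - 1)`! %/ ((g - 1)`! * (m n)`!)) + g * n.
Proof.
case: n => // n g_gt0 _ m_pos.
rewrite card_sum card_prod !card_ord card_sig addnC; congr (_ + _).
transitivity #|calA g n.+1 m n.+1|; first by apply: eq_card.
have binE k : (m k + g - 1)`! %/ ((g - 1)`! * (m k)`!) = 'C(m k + g.-1, m k).
  rewrite -addnBA // subn1 -(bin_fact (leq_addr g.-1 (m k))) addKn.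
  by rewrite [X in _ %/ X]mulnC mulnK // muln_gt0 !fact_gt0.
rewrite card_calA // big_ord_recr /= eqxx subn0 binE; congr (_ * _).
rewrite big_add1 big_mkord; apply: eq_bigr => c _.
by rewrite binE eqSS ltn_eqF.
Qed.

End Counting.

(** * The projective dimension *)

Section QuotientModule.
Variables (R : comNzRingType) (G : R -> Prop).
Local Notation M := (quot_ring_mod G).

Definition quot_class (p : R) : M :=
  \pi_({ideal_quot (gen_ideal G)}) (p : R^o).

Lemma quot_class_scale (a p : R) : a *: quot_class p = quot_class (a * p).
Proof. exact: quot_scale_pi. Qed.

Lemma quot_class_eq0 (p : R) : (quot_class p == 0) = (p \in gen_ideal G).
Proof.
have class0 : quot_class 0 = 0.
  by rewrite -(scale0r (quot_class 0)) quot_class_scale mul0r.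
by rewrite -class0 /quot_class -Quotient.idealrBE subr0.
Qed.

Lemma quot_class_surj (w : M) : exists p, quot_class p = w.
Proof.
by exists (repr (w : {ideal_quot (gen_ideal G)})); apply: reprK.
Qed.

End QuotientModule.

Theorem corollary3p3 (K : fieldType) (g n : nat) (m : nat -> nat)
    (hg : (2 <= g)%N) (hn : (1 <= n)%N)
    (hm1 : (1 <= n - 1)%N -> (1 <= m (n - 1))%N)
    (hm2 : forall i : nat, (1 <= i <= n - 2)%N -> (2 <= m i)%N) :
  is_pd (RmodI g n m K)
    ((\prod_(1 <= i < n)
        ((m i + g - 1)`! %/ ((g - 1)`! * (m i)`!) - g))
     * ((m n + g - 1)`! %/ ((g - 1)`! * (m n)`!)) + g * n)%N.
Proof.
have m_ge2 k : (k.+2 < n)%N -> (1 < m k.+1)%N.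
  by move=> ltkn; apply: hm2; rewrite /= leq_subRL; lia.
have m_pos k : (k.+1 < n)%N -> (0 < m k.+1)%N.
  move=> ltkn; case: (ltnP k.+2 n) => [/m_ge2/ltnW //|lenk].
  have -> : k.+1 = (n - 1)%N by lia.
  by apply: hm1; lia.
rewrite -(card_vars (ltnW hg) hn m_pos).
pose G := Igens (g := g) (n := n) (m := m) (K := K).
apply: (@is_pd_cyclic K _ (RmodI g n m K) (quot_class G 1)
          (quot_class G (socle_mon K g n m))).
- move=> w; have [p <-] := quot_class_surj w; exists p.
  by rewrite quot_class_scale mulr1.
- by rewrite quot_class_eq0; apply: socle_notin.
move=> i; rewrite quot_class_scale; apply/eqP; rewrite quot_class_eq0.
rewrite -[i]enum_valK; case: (enum_val i) => [[j c]|B].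
  exact: mul_xvar_socle.
exact: mul_yvar_socle.
Qed.
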